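(* Let $g(z),h(z),u(z),v(z)$ be polynomials and let $a,b,\eta$ be complex constants with $ab\eta\neq 0$. For an entire function $f$ put $$L(z,f)=g(z)f(z+\eta)+h(z)f'(z)+u(z)f(z)+v(z).$$ If $f$ is an entire function of finite order with $L(z,f)\not\equiv 0$ satisfying $$f(z)^2+L(z,f)=b\,e^{az},$$ then $f$ is of the form $$f(z)=c\,e^{\frac a2 z}+f_0(z),$$ where $c$ is a constant with $c^2=b$ and $f_0(z)=-\tfrac12\left(e^{\frac{a\eta}{2}}g(z)+\tfrac a2 h(z)+u(z)\right)$ is a non-vanishing polynomial.
   Context: The order of an entire function $f$ is $\sigma(f)=\limsup_{r\to\infty}\frac{\log^+T(r,f)}{\log r}$, where $T(r,f)$ is the Nevanlinna characteristic; finite order means $\sigma(f)<\infty$. $L(z,f)\not\equiv 0$ means that, for the given solution $f$, the function $z\mapsto L(z,f)$ is not identically zero. ''Non-vanishing polynomial'' means a polynomial that is not identically zero. *)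

(* Defs.v *)
From HB Require Import structures.
From mathcomp Require Import all_boot all_order all_algebra.
From mathcomp Require Import all_classical all_reals all_analysis.
From mathcomp Require Export complex.

Set Implicit Arguments.
Unset Strict Implicit.
Unset Printing Implicit Defensive.

Import Order.TTheory GRing.Theory Num.Theory.
Import numFieldNormedType.Exports.
Local Open Scope classical_set_scope.
Local Open Scope ring_scope.
Local Open Scope complex_scope.

(* C = R[i] with its usual topology, as a normed space over itself. *)
HB.instance Definition _ (R : realType) := NormedModule.copy R[i] (R[i]^o).

(* exp (x + i y) = exp x * (cos y + i sin y) *)
Definition cexp (R : realType) (z : R[i]) : R[i] :=
  (expR (complex.Re z))%:C *
  (cos (complex.Im z) +i* sin (complex.Im z)).

(* Complex differentiability at every point: the difference quotient is taken
   along h in C, not along real h. *)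
Definition entire (R : realType) (f : R[i] -> R[i]) : Prop :=
  forall z : R[i], derivable f z 1.

(* The library sets ln x = 0 for x <= 0, hence log^+ 0 = 0 as usual. *)
Definition logp (R : realType) (x : R) : R := Num.max 0 (ln x).

(* The proximity function
   m(r, f) = (2 pi)^-1 \int_0^(2 pi) log^+ |f(r e^(it))| dt.
   On R[i] the norm `|z| is itself an element of R[i], whence the Re. *)
Definition proximity (R : realType) (f : R[i] -> R[i]) (r : R) : \bar R :=
  (((pi *+ 2)^-1)%:E *
   \int[lebesgue_measure]_(t in `[0%R, (pi *+ 2)%R])
      (logp (complex.Re `|f (r%:C * cexp (0 +i* t))|))%:E)%E.

(* The multiplicity of p as a pole of a meromorphic f: the least k such that
   (z - p)^k f(z) is bounded on a punctured neighbourhood of p.  It is 0 when p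
   is not a pole, and the value of f at p itself is irrelevant. *)
Definition pole_mult (R : realType) (f : R[i] -> R[i]) (p : R[i]) : \bar R :=
  ereal_inf [set (k%:R)%:E | k in
    [set k : nat | bounded_near (fun z : R[i] => (z - p) ^+ k * f z) p^']].

(* n(t, f): the number of poles in the closed disc of radius t, counted with
   multiplicity. *)
Definition pole_count (R : realType) (f : R[i] -> R[i]) (t : R) : \bar R :=
  \esum_(p in [set p : R[i] | `|p| <= t%:C]) pole_mult f p.

(* The integrated counting function
   N(r, f) = \int_0^r (n(t, f) - n(0, f)) / t dt + n(0, f) log r. *)
Definition integrated_count (R : realType) (f : R[i] -> R[i]) (r : R) : \bar R :=
  (\int[lebesgue_measure]_(t in `]0%R, r])
     ((pole_count f t - pole_count f 0%R) * (t^-1)%:E)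
   + pole_count f 0%R * (ln r)%:E)%E.

(* The Nevanlinna characteristic T(r, f) = m(r, f) + N(r, f). *)
Definition nevanlinna_char (R : realType) (f : R[i] -> R[i]) (r : R) : \bar R :=
  (proximity f r + integrated_count f r)%E.

(* limsup_(r -> +oo) log^+ T(r, f) / log r.  Here lne is the library's
   logarithm on extended reals, with lne x = -oo for x <= 0. *)
Definition growth_order (R : realType) (f : R[i] -> R[i]) : \bar R :=
  limf_esup
    (fun r : R =>
       Order.max 0%E (lne (nevanlinna_char f r)) * ((ln r)^-1)%:E)%E
    (pinfty_nbhs R).

(* L(z, f) = g(z) f(z + eta) + h(z) f'(z) + u(z) f(z) + v(z) *)
Definition Lop (R : realType) (g h u v : {poly R[i]}) (eta : R[i])
    (f : R[i] -> R[i]) (z : R[i]) : R[i] :=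
  g.[z] * f (z + eta) + h.[z] * derive1 f z + u.[z] * f z + v.[z].

(* Main.v *)
Require Import Defs.
From mathcomp Require Import all_boot all_order all_algebra.
From mathcomp Require Import all_classical all_reals all_analysis.
From mathcomp Require Import complex ring lra.
Set Implicit Arguments.
Unset Strict Implicit.
Unset Printing Implicit Defensive.
Import Order.TTheory GRing.Theory Num.Theory.
Import numFieldNormedType.Exports.
Local Open Scope classical_set_scope.
Local Open Scope ring_scope.
Local Open Scope complex_scope.

(* Put E(z) = exp(a z / 2).  A bound log+ |f| <= K (1 + |z|)^k follows from the
   finite order.  The equation f^2 = b E^2 - L(z, f), in which L is bounded by a
   polynomial times the maximum of |f| on a disc of fixed radius, halves the
   exponent each time it is used, so it improves the bound to
   |f| <= C (1 + |z|)^N max(1, |E|).  Hence f^2 / E^2 = b + small once Re (a z)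
   exceeds a large multiple of log |z|; in this connected region f / E stays
   near one square root c of b, and f - c E = - L / (f + c E) has polynomial
   growth there.  Elsewhere f and E themselves have polynomial growth, so
   f - c E is a polynomial by Liouville's theorem.  Comparing the coefficients
   of E in the equation identifies it with f_0; if f_0 = 0, then L = 0.

   The function theory rests on the maximum principle, which comes from
   Goursat's bisection applied to Riemann sums over exp-coordinates; applied to
   difference quotients it gives Cauchy's estimate and Liouville's theorem, and
   applied to products of rotated copies of f it gives the Poisson-Jensen bound
   of log |f| by the Nevanlinna characteristic. *)

(** The obstacle is that [f (z + eta)] and [f' z] are not controlled by [|f z|], only by the maximum
    of [|f|] on the disc of radius [1 + |eta|] around [z]. Each use of the equation therefore
    enlarges the disc while it halves the exponent. The halving wins: after [j] uses the exponent is
    [K (1 + |z| + j (1 + |eta|)) ^ k / 2 ^ j], which for every [z] drops below 1 once [j] is large.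
    This is where finite order enters, and the only place.

    The gain is that [f ^ 2 - b E ^ 2] is bounded by a polynomial times one power of [E], not two.
    Dividing by [f + c E], of size at least [|c E|], then leaves only the polynomial. The polynomial
    factor also dictates the shape of the region: it has to be absorbed by [|E|], so the boundary
    must be a logarithmic curve rather than a line [Re (a z) = constant]. *)

(** * The modulus as a real number, and continuity in terms of it *)

Section Modulus.
Context (R : realType).
Implicit Types z w : R[i].

(** A modulus with values in [R] makes estimates accessible to [lra] and to the total order. *)
Definition cmod z : R := complex.Re `|z|.

Lemma cmodE z : `|z| = (cmod z)%:C.
Proof. by rewrite /cmod normc_def. Qed.

Lemma cmod_sqrt z :
  cmod z = Num.sqrt (complex.Re z ^+ 2 + complex.Im z ^+ 2).
Proof. by rewrite /cmod normc_def. Qed.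

Lemma cmod_ge0 z : 0 <= cmod z.
Proof. by rewrite cmod_sqrt sqrtr_ge0. Qed.

Lemma cmodM z w : cmod (z * w) = cmod z * cmod w.
Proof. by apply/complexI; rewrite rmorphM/= -!cmodE normrM. Qed.

Lemma cmodD z w : cmod (z + w) <= cmod z + cmod w.
Proof. by rewrite -lecR rmorphD/= -!cmodE ler_normD. Qed.

Lemma cmodN z : cmod (- z) = cmod z.
Proof. by apply/complexI; rewrite -!cmodE normrN. Qed.

Lemma cmodB z w : cmod (z - w) <= cmod z + cmod w.
Proof. by rewrite -(cmodN w); exact: cmodD. Qed.

Lemma cmodBC z w : cmod (z - w) = cmod (w - z).
Proof. by rewrite -cmodN opprB. Qed.

Lemma cmodV z : cmod z^-1 = (cmod z)^-1.
Proof. by apply/complexI; rewrite fmorphV/= -!cmodE normfV. Qed.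

Lemma cmodX z n : cmod (z ^+ n) = cmod z ^+ n.
Proof. by apply/complexI; rewrite rmorphXn/= -!cmodE normrX. Qed.

Lemma cmod0 : cmod 0 = 0.
Proof. by apply/complexI; rewrite -cmodE normr0. Qed.

Lemma cmod1 : cmod 1 = 1.
Proof. by apply/complexI; rewrite -cmodE normr1. Qed.

Lemma cmod_real (x : R) : cmod x%:C = `|x|.
Proof. by rewrite cmod_sqrt /= expr0n addr0 sqrtr_sqr. Qed.

Lemma cmod_nat n : cmod n%:R = n%:R.
Proof. by apply/complexI; rewrite -cmodE rmorph_nat normr_nat. Qed.

Lemma cmod_eq0 z : (cmod z == 0) = (z == 0).
Proof. by rewrite -(inj_eq (@complexI _)) -cmodE normr_eq0. Qed.

Lemma cmod_gt0 z : (0 < cmod z) = (z != 0).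
Proof. by rewrite lt0r cmod_ge0 andbT cmod_eq0. Qed.

Lemma cmod_prod I (r : seq I) (P : pred I) (F : I -> R[i]) :
  cmod (\prod_(i <- r | P i) F i) = \prod_(i <- r | P i) cmod (F i).
Proof. exact: (big_morph cmod cmodM cmod1). Qed.

Lemma cmod_sum_le I (r : seq I) (P : pred I) (F : I -> R[i]) :
  cmod (\sum_(i <- r | P i) F i) <= \sum_(i <- r | P i) cmod (F i).
Proof.
elim/big_ind2: _ => [|x1 x2 y1 y2 h1 h2|//]; first by rewrite cmod0.
by rewrite (le_trans (cmodD _ _)) ?lerD.
Qed.

Lemma Re_le_cmod z : complex.Re z <= cmod z.
Proof.
by rewrite cmod_sqrt (le_trans (ler_norm _))// -sqrtr_sqr ler_wsqrtr// lerDl sqr_ge0.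
Qed.

Lemma cmod_le_ReIm z : cmod z <= `|complex.Re z| + `|complex.Im z|.
Proof.
rewrite {1}[z]complexE (le_trans (cmodD _ _))// cmodM !cmod_real.
by rewrite /cmod normc_def/= expr0n/= expr1n add0r sqrtr1 mul1r.
Qed.

(* Boxed, so that unification never unfolds the filters. *)
Variant ccont (f : R[i] -> R[i]) z : Prop := CCont of {for z, continuous f}.

(** A positive element of [R[i]] is real, so all radii of the norm topology can be taken in [R]. *)
Lemma ccontP (f : R[i] -> R[i]) z :
  ccont f z <->
  forall e : R, 0 < e -> exists2 d : R, 0 < d &
    forall w, cmod (w - z) < d -> cmod (f w - f z) < e.
Proof.
have F := nbhs_filter z.
split=> [[/cvgrPdist_lt h] e e0|h].
  have e0' : 0 < e%:C by rewrite ltcR.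
  have /nbhs_normP[d /= d0 hd] := h _ e0'.
  have [dr dE] : exists d' : R, d = d'%:C.
    by apply/complex_realP; rewrite gtr0_real.
  rewrite dE ltcR in d0; exists dr => // w wd.
  have : ball z d w by rewrite -ball_normE/= dE distrC cmodE ltcR.
  by move=> /hd/=; rewrite distrC cmodE ltcR.
split; apply/cvgrPdist_lt => e e0.
have [er eE] : exists d' : R, e = d'%:C.
  by apply/complex_realP; rewrite gtr0_real.
rewrite eE ltcR in e0.
have [d d0 hd] := h _ e0.
apply/nbhs_normP; exists d%:C => /=; first by rewrite ltcR.
move=> w; rewrite /ball_/= distrC cmodE ltcR => /hd.
by rewrite distrC cmodE eE ltcR.
Qed.

End Modulus.

(** * Calculus of complex differentiable functions *)

Section ComplexDifferentiability.
Context (R : realType).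
Implicit Types (f g : R[i] -> R[i]) (z w : R[i]).

Lemma contM f g z : ccont f z -> ccont g z ->
  ccont (fun w => f w * g w) z.
Proof. by move=> [hf] [hg]; exact: CCont (continuousM hf hg). Qed.

Lemma contD f g z : ccont f z -> ccont g z ->
  ccont (fun w => f w + g w) z.
Proof. by move=> [hf] [hg]; exact: CCont (continuousD hf hg). Qed.

Lemma contB f g z : ccont f z -> ccont g z ->
  ccont (fun w => f w - g w) z.
Proof. by move=> [hf] [hg]; exact: CCont (continuousB hf hg). Qed.

Lemma contV f z : f z != 0 -> ccont f z ->
  ccont (fun w => (f w)^-1) z.
Proof. by move=> fz0 [hf]; exact: CCont (continuousV fz0 hf). Qed.

Lemma cont_cst (c : R[i]) z : ccont (fun _ : R[i] => c) z.
Proof. exact: CCont (@cst_continuous _ _ c z). Qed.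

Lemma cont_id z : ccont (fun w : R[i] => w) z.
Proof. exact: CCont (@cvg_id _ _). Qed.

Lemma cont_comp f g z : ccont f z -> ccont g (f z) ->
  ccont (fun w => g (f w)) z.
Proof. by move=> [hf] [hg]; exact: CCont (continuous_comp hf hg). Qed.

Lemma cont_eq_near f g z (d : R) : 0 < d ->
  (forall w, cmod (w - z) < d -> f w = g w) ->
  ccont f z -> ccont g z.
Proof.
move=> d0 fg /ccontP h; apply/ccontP => e e0.
have [d' d'0 hd'] := h e e0.
exists (Num.min d d'); first by rewrite lt_min d0.
move=> w; rewrite lt_min => /andP[/fg <- /hd'].
by rewrite (fg z)// subrr cmod0.
Qed.

(* Caratheodory's form of differentiability. *)
Definition cdiff f z := exists2 q : R[i] -> R[i],
  ccont q z & forall w, f w = f z + (w - z) * q w.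

Lemma cdiff_cont f z : cdiff f z -> ccont f z.
Proof.
move=> [q qc fE].
apply: (@cont_eq_near (fun w => f z + (w - z) * q w) f z 1 ltr01).
  by move=> w _; rewrite -fE.
exact: contD (cont_cst _ _) (contM (contB (cont_id _) (cont_cst _ _)) qc).
Qed.

Lemma cdiff_cst (c : R[i]) z : cdiff (fun=> c) z.
Proof. by exists (fun=> 0) => [|w]; [exact: cont_cst|rewrite mulr0 addr0]. Qed.

Lemma cdiff_id z : cdiff (fun w => w) z.
Proof.
by exists (fun=> 1) => [|w]; [exact: cont_cst|rewrite /= mulr1 addrC subrK].
Qed.

Lemma cdiffD f g z : cdiff f z -> cdiff g z -> cdiff (fun w => f w + g w) z.
Proof.
move=> [p pc fE] [q qc gE]; exists (fun w => p w + q w); first exact: contD.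
by move=> w; rewrite fE gE; ring.
Qed.

Lemma cdiffM f g z : cdiff f z -> cdiff g z -> cdiff (fun w => f w * g w) z.
Proof.
move=> df [q qc gE]; have [p pc fE] := df.
exists (fun w => p w * g z + f w * q w).
  exact: contD (contM pc (cont_cst _ _)) (contM (cdiff_cont df) qc).
by move=> w; rewrite gE fE; ring.
Qed.

Lemma cdiffB f g z : cdiff f z -> cdiff g z -> cdiff (fun w => f w - g w) z.
Proof.
move=> df dg; rewrite (_ : (fun w => _) = (fun w => f w + (-1) * g w)).
  exact: cdiffD df (cdiffM (cdiff_cst _ _) dg).
by apply/funext => w; rewrite mulN1r.
Qed.

Lemma cdiff_comp f g z :
  cdiff f z -> cdiff g (f z) -> cdiff (fun w => g (f w)) z.
Proof.
move=> df [q qc gE]; have [p pc fE] := df.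
exists (fun w => p w * q (f w)).
  exact: contM pc (cont_comp (cdiff_cont df) qc).
move=> w; have e : f w - f z = (w - z) * p w by rewrite fE; ring.
by rewrite (gE (f w)) e; ring.
Qed.

Lemma cdiff_inv z : z != 0 -> cdiff (fun w => w^-1) z.
Proof.
move=> z0.
(* Since [0^-1 = 0], the equation of [cdiff] at [w = 0] reads [0 = z^-1 - z * q 0] and forces this
   value. *)
exists (fun w => if w == 0 then (z ^+ 2)^-1 else - (z * w)^-1); last first.
  move=> w; case: eqP => [->|/eqP w0].
    by rewrite invr0; field.
  by field; rewrite z0 w0.
apply: (@cont_eq_near (fun w => 0 - (z * w)^-1) _ _ (cmod z)).
- by rewrite cmod_gt0.
- move=> w; case: eqP => [->|_ _]; last by rewrite sub0r.
  by rewrite sub0r cmodN ltxx.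
- apply: contB (cont_cst _ _) _.
  apply: (@contV (fun w => z * w)); first by rewrite mulf_neq0.
  exact: contM (cont_cst _ _) (cont_id _).
Qed.

Lemma cdiffV f z : f z != 0 -> cdiff f z -> cdiff (fun w => (f w)^-1) z.
Proof. by move=> fz0 df; exact: cdiff_comp df (cdiff_inv fz0). Qed.

(** The equation in [cdiff] is global while differentiability is local: away from [z] the quotient
    has to be replaced by that of [g], and near [z] the two agree. *)
Lemma cdiff_eq_near f g z (d : R) : 0 < d ->
  (forall w, cmod (w - z) < d -> f w = g w) -> cdiff f z -> cdiff g z.
Proof.
move=> d0 fg [q qc fE].
exists (fun w => if w == z then q w else (g w - g z) / (w - z)); last first.
  move=> w; case: eqP => [->|/eqP wz]; first by rewrite subrr mul0r addr0.
  by rewrite mulrC divfK ?subr_eq0// addrC subrK.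
apply: cont_eq_near d0 _ qc => w wd; case: eqP => [//|/eqP wz].
rewrite -(fg w wd) -(fg z); last by rewrite subrr cmod0 (le_lt_trans _ wd) ?cmod_ge0.
by rewrite (fE w) addrAC subrr add0r mulrAC mulfV ?mul1r// subr_eq0.
Qed.

Lemma cdiffX f n z : cdiff f z -> cdiff (fun w => f w ^+ n) z.
Proof.
move=> df; elim: n => [|n IHn]; first exact: cdiff_cst.
rewrite (_ : (fun w => _) = (fun w => f w * f w ^+ n)); first exact: cdiffM.
by apply/funext => w; rewrite exprS.
Qed.

Lemma cdiff_prod (I : Type) (r : seq I) (F : I -> R[i] -> R[i]) z :
  (forall i, cdiff (F i) z) -> cdiff (fun w => \prod_(i <- r) F i w) z.
Proof.
move=> dF; elim: r => [|i r IHr].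
  by under eq_fun do rewrite big_nil; exact: cdiff_cst.
by under eq_fun do rewrite big_cons; exact: cdiffM.
Qed.

Lemma cdiff_poly (p : {poly R[i]}) z : cdiff (fun w => p.[w]) z.
Proof.
elim/poly_ind: p => [|p c IHp].
  by under eq_fun do rewrite horner0; exact: cdiff_cst.
under eq_fun do rewrite hornerMXaddC.
exact: cdiffD (cdiffM IHp (cdiff_id _)) (cdiff_cst _ _).
Qed.

(** Recording [q z] makes the derivative a value of a continuous function, to which the maximum
    principle applies. *)
Lemma derivable_cdiff f z : derivable f z 1 ->
  exists q : R[i] -> R[i],
    [/\ ccont q z, forall w, f w = f z + (w - z) * q w & q z = derive1 f z].
Proof.
move=> df.
exists (fun w => if w == z then derive1 f z else (f w - f z) / (w - z)).
split; last by rewrite eqxx.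
  apply/ccontP => e e0; rewrite eqxx.
  have e0' : 0 < e%:C by rewrite ltcR.
  have F := @dnbhs_filter R[i] 0.
  have D : (fun h => h^-1 *: (f (h *: 1 + z) - f z)) @ 0^' --> 'D_1 f z by exact: df.
  move/(@cvgrPdist_lt _ _ _ _ F) : D => /(_ _ e0')/nbhs_normP[d /= d0 hd].
  have [dr dE] : exists d' : R, d = d'%:C.
    by apply/complex_realP; rewrite gtr0_real.
  rewrite dE ltcR in d0; exists dr => // w wd.
  case: eqP => [_|/eqP wz]; first by rewrite subrr cmod0.
  have /hd/= : ball_ Num.norm 0 d (w - z) by rewrite /ball_/= dE sub0r normrN cmodE ltcR.
  rewrite subr_eq0 => /(_ wz).
  by rewrite distrC cmodE ltcR -derive1E /GRing.scale/= mulr1 subrK mulrC.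
move=> w; case: eqP => [->|/eqP wz]; first by rewrite subrr mul0r addr0.
by rewrite mulrC divfK ?subr_eq0// addrC subrK.
Qed.

Lemma entire_cdiff f z : entire f -> cdiff f z.
Proof. by move=> /(_ z)/derivable_cdiff[q [qc fE _]]; exists q. Qed.

End ComplexDifferentiability.

(** * Goursat's lemma for Riemann sums over parallelograms *)

Section DyadicContourSums.
Context (R : realType).
Implicit Types (F G : R[i] -> R[i]) (p d e w : R[i]) (n k : nat).

(* The left Riemann sum, with [2 ^ n] nodes, of the integral of [F] along the
   segment from [p] to [p + d]. *)
Definition seg_sum F n p d : R[i] :=
  d / 2%:R ^+ n * \sum_(k < 2 ^ n) F (p + k%:R / 2%:R ^+ n * d).

(** The sum over the boundary of the parallelogram with corner [p] and sides [d], [e], traversed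
    from [p] by way of [p + d]. *)
Definition par_sum F n p d e : R[i] :=
  seg_sum F n p d + seg_sum F n (p + d) e
  - seg_sum F n (p + e) d - seg_sum F n p e.

Lemma pow2C_neq0 n : 2%:R ^+ n != 0 :> R[i].
Proof. by rewrite expf_neq0 ?pnatr_eq0. Qed.

Lemma seg_sum_halves F n p d :
  seg_sum F n.+1 p d = seg_sum F n p (d / 2%:R) + seg_sum F n (p + d / 2%:R) (d / 2%:R).
Proof.
have n0 := pow2C_neq0 n.
rewrite /seg_sum expnS mul2n -addnn big_split_ord/= mulrDr; congr (_ + _).
  rewrite exprS; congr (_ * _); first by field.
  by apply: eq_bigr => k _; congr (F (_ + _)); field.
rewrite exprS; congr (_ * _); first by field.
by apply: eq_bigr => k _; rewrite natrD natrX -addrA; congr (F (_ + _)); field.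
Qed.

(** An identity, not an approximation: the nodes of a side are those of its two halves, and every
    inner edge is shared by two quarters with opposite signs. *)
Lemma par_sum_quarters F n p d e :
  par_sum F n.+1 p d e =
    par_sum F n p (d / 2%:R) (e / 2%:R)
    + par_sum F n (p + d / 2%:R) (d / 2%:R) (e / 2%:R)
    + par_sum F n (p + e / 2%:R) (d / 2%:R) (e / 2%:R)
    + par_sum F n (p + d / 2%:R + e / 2%:R) (d / 2%:R) (e / 2%:R).
Proof.
rewrite /par_sum !seg_sum_halves.
have half x : x / 2%:R + x / 2%:R = x :> R[i] by field.
have -> : p + d / 2%:R + d / 2%:R = p + d by rewrite -addrA half.
have -> : p + d / 2%:R + e / 2%:R + d / 2%:R = p + d + e / 2%:R.
  by rewrite addrAC -(addrA p) half.
have -> : p + d / 2%:R + e / 2%:R + e / 2%:R = p + e + d / 2%:R.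
  by rewrite -addrA half addrAC.
have -> : p + e / 2%:R + e / 2%:R = p + e by rewrite -addrA half.
have -> : p + e / 2%:R + d / 2%:R = p + d / 2%:R + e / 2%:R by rewrite addrAC.
ring.
Qed.

(** A left Riemann sum is not exact for an affine function, but its error depends only on the
    direction vector of the segment, so it cancels between opposite sides. *)
Lemma par_sum_affine (A B : R[i]) n p d e :
  par_sum (fun w => A + B * w) n p d e = 0.
Proof.
have n0 := pow2C_neq0 n.
pose c : R[i] := (\sum_(k < 2 ^ n) k%:R) / 2%:R ^+ n / 2%:R ^+ n.
have E q u : seg_sum (fun w => A + B * w) n q u = u * (A + B * q) + B * u ^+ 2 * c.
  rewrite /seg_sum.
  rewrite (eq_bigr (fun k : 'I_(2 ^ n) => A + B * q + B * u / 2%:R ^+ n * k%:R)).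
  2: by move=> k _; field.
  rewrite big_split/= -mulr_sumr sumr_const card_ord -[_ *+ (2 ^ n)]mulr_natl natrX /c.
  by field.
by rewrite /par_sum !E; ring.
Qed.

Lemma par_sumB F G n p d e :
  par_sum (fun w => F w - G w) n p d e = par_sum F n p d e - par_sum G n p d e.
Proof.
by rewrite /par_sum /seg_sum !sumrB; ring.
Qed.

Lemma seg_sum_le F n p d (M : R) :
  (forall t : R, 0 <= t <= 1 -> cmod (F (p + t%:C * d)) <= M) ->
  cmod (seg_sum F n p d) <= cmod d * M.
Proof.
move=> FM.
have n0 : 0 < 2%:R ^+ n :> R by rewrite exprn_gt0.
rewrite /seg_sum !cmodM cmodV cmodX cmod_nat -mulrA ler_wpM2l ?cmod_ge0//.
rewrite mulrC ler_pdivrMr// (le_trans (cmod_sum_le _ _ _))//.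
rewrite (_ : M * _ = \sum_(k < 2 ^ n) M).
  2: by rewrite sumr_const card_ord -[M *+ (2 ^ n)]mulr_natr natrX.
apply: ler_sum => k _.
rewrite (_ : k%:R / _ = (k%:R / 2%:R ^+ n : R)%:C).
  apply: FM; rewrite divr_ge0 ?(ltW n0)//= ler_pdivrMr// mul1r -natrX ler_nat.
  exact/ltnW.
by rewrite rmorphM/= fmorphV/= rmorphXn/= !rmorph_nat.
Qed.

Lemma par_sum_near_affine F (A B : R[i]) n p d e (M : R) :
  (forall (s t : R) w, 0 <= s <= 1 -> 0 <= t <= 1 ->
    w = p + s%:C * d + t%:C * e -> cmod (F w - (A + B * w)) <= M) ->
  cmod (par_sum F n p d e) <= (cmod d + cmod e) * M *+ 2.
Proof.
move=> FM.
rewrite -[par_sum F _ _ _ _]subr0 -(par_sum_affine A B n p d e) -par_sumB.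
have I0 : 0 <= (0 : R) <= 1 by rewrite lexx ler01.
have I1 : 0 <= (1 : R) <= 1 by rewrite lexx ler01.
have h1 : cmod (seg_sum (fun w => F w - (A + B * w)) n p d) <= cmod d * M.
  apply: seg_sum_le => t tI.
  by apply: (FM t 0) => //; rewrite rmorph0 mul0r addr0.
have h2 : cmod (seg_sum (fun w => F w - (A + B * w)) n (p + d) e) <= cmod e * M.
  apply: seg_sum_le => t tI.
  by apply: (FM 1 t) => //; rewrite rmorph1 mul1r.
have h3 : cmod (seg_sum (fun w => F w - (A + B * w)) n (p + e) d) <= cmod d * M.
  apply: seg_sum_le => t tI.
  by apply: (FM t 1) => //; rewrite rmorph1 mul1r addrAC.
have h4 : cmod (seg_sum (fun w => F w - (A + B * w)) n p e) <= cmod e * M.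
  apply: seg_sum_le => t tI.
  by apply: (FM 0 t) => //; rewrite rmorph0 mul0r addr0.
rewrite /par_sum.
apply: le_trans (cmodB _ _) _.
apply: le_trans (lerD (cmodB _ _) (lexx _)) _.
apply: le_trans (lerD (lerD (cmodD _ _) (lexx _)) (lexx _)) _.
move: h1 h2 h3 h4; lra.
Qed.

Lemma nested_intervals (u : nat -> R) (l : nat -> R) :
  (forall k, u k <= u k.+1) -> (forall k, u k.+1 + l k.+1 <= u k + l k) ->
  (forall k, 0 <= l k) ->
  exists x, forall k, u k <= x <= u k + l k.
Proof.
move=> hu hl l0.
have mu i j : (i <= j)%N -> u i <= u j.
  by move=> /subnKC <-; elim: (j - i)%N => [|m IH]; rewrite ?addn0// addnS (le_trans IH).
have ml i j : (i <= j)%N -> u j + l j <= u i + l i.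
  by move=> /subnKC <-; elim: (j - i)%N => [|m IH]; rewrite ?addn0// addnS (le_trans _ IH).
have b i j : u i <= u j + l j.
  case: (leqP i j) => [ij|/ltnW ji].
    by rewrite (le_trans (mu _ _ ij))// lerDl.
  by rewrite (le_trans _ (ml _ _ ji))// lerDl.
exists (sup (range u)) => k; apply/andP; split.
  apply: ub_le_sup; last by exists k.
  by exists (u k + l k) => _ [i _ <-].
by apply: ge_sup; [exists (u 0%N), 0%N|move=> _ [i _ <-]].
Qed.

(* Goursat's bisection argument, run on the Riemann sums: no integral is
   needed, since the sums at level n + 1 of a parallelogram are exactly the
   sums at level n of its four quarters. *)
Lemma goursat F p d e :
  (forall s t : R, 0 <= s <= 1 -> 0 <= t <= 1 -> cdiff F (p + s%:C * d + t%:C * e)) ->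
  forall eps : R, 0 < eps ->
  exists m, forall n, (m <= n)%N -> cmod (par_sum F n p d e) <= eps.
Proof.
move=> dF eps eps0; apply: contrapT => nbd.
pose sc k (x : R[i]) := x / 2%:R ^+ k.
(* A triple [(k, x, y)] encodes the parallelogram with corner [p + x d + y e] and sides [d / 2 ^ k],
   [e / 2 ^ k]. No limit of the sums is known to exist, so bad means exceeding [eps / 4 ^ k] at
   arbitrarily high levels. *)
pose bad (x : nat * R * R) :=
  [/\ 0 <= x.1.2, 0 <= x.2, x.1.2 + (2%:R ^+ x.1.1)^-1 <= 1,
      x.2 + (2%:R ^+ x.1.1)^-1 <= 1 &
  forall m, exists2 n, (m <= n)%N &
    eps / 4%:R ^+ x.1.1 < cmod (par_sum F n (p + x.1.2%:C * d + x.2%:C * e)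
      (sc x.1.1 d) (sc x.1.1 e))].
pose step (x y : nat * R * R) :=
  [/\ y.1.1 = x.1.1.+1,
    x.1.2 <= y.1.2, y.1.2 + (2%:R ^+ y.1.1)^-1 <= x.1.2 + (2%:R ^+ x.1.1)^-1,
    x.2 <= y.2 & y.2 + (2%:R ^+ y.1.1)^-1 <= x.2 + (2%:R ^+ x.1.1)^-1].
have pw k : (2%:R ^+ k)^-1 = (2%:R ^+ k.+1)^-1 *+ 2 :> R.
  by rewrite exprS; field; rewrite expf_neq0.
have pw0 k : 0 < (2%:R ^+ k)^-1 :> R by rewrite invr_gt0 exprn_gt0.
have bad0 : bad (0%N, 0, 0).
  split; rewrite /= ?expr0 ?invr1 ?add0r// => m.
  apply: contrapT => h; apply: nbd; exists m => n mn.
  rewrite leNgt; apply/negP => hlt; apply: h; exists n => //.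
  by rewrite /sc !expr0 !divr1 !rmorph0 !mul0r !addr0 ?mulr1.
have badS x : bad x -> exists2 y, bad y & step x y.
  case: x => [[k a] b] [/= a0 b0 a1 b1 hbad].
  apply: contrapT => hno.
  have good (i j : bool) : exists m, forall n, (m <= n)%N ->
      cmod (par_sum F n (p + a%:C * d + b%:C * e + i%:R * sc k.+1 d + j%:R * sc k.+1 e)
        (sc k.+1 d) (sc k.+1 e)) <= eps / 4%:R ^+ k.+1.
    apply: contrapT => hm; apply: hno.
    have a2 := pw k; have a3 := pw0 k.+1.
    exists (k.+1, a + i%:R * (2%:R ^+ k.+1)^-1, b + j%:R * (2%:R ^+ k.+1)^-1).
      split => /=.
      - by case: (i); rewrite ?mul1r ?mul0r; lra.
      - by case: (j); rewrite ?mul1r ?mul0r; lra.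
      - by case: (i); rewrite ?mul1r ?mul0r; lra.
      - by case: (j); rewrite ?mul1r ?mul0r; lra.
      move=> m; apply: contrapT => h; apply: hm; exists m => n mn.
      rewrite leNgt; apply/negP => hlt; apply: h; exists n => //.
      rewrite (_ : _ + _ + _ =
        p + a%:C * d + b%:C * e + i%:R * sc k.+1 d + j%:R * sc k.+1 e)//.
      rewrite !rmorphD/= !rmorphM/= !fmorphV/= !rmorphXn/= !rmorph_nat /sc.
      by ring.
    split => //=.
    - by case: (i); rewrite ?mul1r ?mul0r; lra.
    - by case: (i); rewrite ?mul1r ?mul0r; lra.
    - by case: (j); rewrite ?mul1r ?mul0r; lra.
    - by case: (j); rewrite ?mul1r ?mul0r; lra.
  have [m1 h1] := good false false; have [m2 h2] := good true false.
  have [m3 h3] := good false true; have [m4 h4] := good true true.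
  (* One more than the four thresholds together, because the quarters are summed one level lower. *)
  have [n nm hn] := hbad (m1 + m2 + m3 + m4).+1%N.
  case: n nm hn => // n; rewrite ltnS => nm.
  have scS x : sc k x / 2%:R = sc k.+1 x.
    by rewrite /sc exprSr invfM mulrA.
  rewrite par_sum_quarters !scS.
  have {}h1 := h1 n (leq_trans _ nm); have {}h2 := h2 n (leq_trans _ nm).
  have {}h3 := h3 n (leq_trans _ nm); have {}h4 := h4 n (leq_trans _ nm).
  move: h1; rewrite !mul0r !addr0 => /(_ _)h1.
  move: h2; rewrite !mul0r !addr0 mul1r => /(_ _)h2.
  move: h3; rewrite !mul0r !addr0 mul1r => /(_ _)h3.
  move: h4; rewrite !mul1r => /(_ _)h4.
  apply/negP; rewrite -leNgt.
  have e4 : eps / 4%:R ^+ k = eps / 4%:R ^+ k.+1 *+ 4.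
    by rewrite exprS invfM; field; rewrite expf_neq0.
  rewrite e4.
  apply: le_trans (cmodD _ _) _.
  apply: le_trans (lerD (cmodD _ _) (lexx _)) _.
  apply: le_trans (lerD (lerD (cmodD _ _) (lexx _)) (lexx _)) _.
  have l1 : (m1 <= m1 + m2 + m3 + m4)%N by rewrite -!addnA leq_addr.
  have l2 : (m2 <= m1 + m2 + m3 + m4)%N by rewrite -!addnA addnCA leq_addr.
  have l3 : (m3 <= m1 + m2 + m3 + m4)%N by rewrite -addnA addnCA leq_addr.
  have l4 : (m4 <= m1 + m2 + m3 + m4)%N by rewrite leq_addl.
  by move: (h1 l1) (h2 l2) (h3 l3) (h4 l4); lra.
have [x0 x0E] : exists x0 : {x | bad x}, sval x0 = (0%N, 0, 0) by exists (exist _ _ bad0).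
have nxt (x : {x | bad x}) : exists y : {x | bad x}, step (sval x) (sval y).
  case: x => x bx; have [y yb xy] := badS _ bx.
  by exists (exist _ y yb).
have [x [xi xs]] := dependent_choice (fun x => cid (nxt x)) x0.
have xk k : (sval (x k)).1.1 = k.
  elim: k => [|k IH]; first by rewrite xi x0E.
  by have [-> _ _ _ _] := xs k; rewrite IH.
pose al k := (sval (x k)).1.2; pose be k := (sval (x k)).2.
have [a ha] : exists a, forall k, al k <= a <= al k + (2%:R ^+ k)^-1.
  apply: nested_intervals => k; last exact/ltW/pw0.
    by have [_ ? _ _ _] := xs k.
  by have [_ _ + _ _] := xs k; rewrite !xk.
have [b hb] : exists b, forall k, be k <= b <= be k + (2%:R ^+ k)^-1.
  apply: nested_intervals => k; last exact/ltW/pw0.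
    by have [_ _ _ ? _] := xs k.
  by have [_ _ _ _ +] := xs k; rewrite !xk.
have [] : 0 <= a <= 1 /\ 0 <= b <= 1.
  have := ha 0%N; have := hb 0%N; rewrite /al /be xi x0E/= expr0 invr1 !add0r.
  by split.
move=> aI bI; have [q /ccontP qc FE] := dF a b aI bI.
set w0 := p + a%:C * d + b%:C * e in qc FE.
pose s := cmod d + cmod e.
have s0 : 0 <= s by rewrite addr_ge0 ?cmod_ge0.
(* At stage [k] the perimeter is at most [2 s / 2 ^ k] and the deviation from the tangent map at
   most [eta s / 2 ^ k]; the product [2 s ^ 2 eta / 4 ^ k] must not exceed [eps / 4 ^ k]. The
   summand 1 guards against [s = 0]. *)
pose eta := eps / (s ^+ 2 *+ 2 + 1).
have den0 : 0 < s ^+ 2 *+ 2 + 1 by rewrite ltr_wpDl// mulrn_wge0 ?sqr_ge0.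
have eta0 : 0 < eta by rewrite divr_gt0.
have [dl dl0 hdl] := qc eta eta0.
have [k hk] : exists k, s / 2%:R ^+ k < dl.
  exists (Num.Def.archi_bound (s / dl)).
  rewrite ltr_pdivrMr ?exprn_gt0// mulrC -ltr_pdivrMr//.
  have := archi_boundP (divr_ge0 s0 (ltW dl0)) => /lt_le_trans; apply.
  by rewrite -natrX ler_nat ltnW// ltn_expl.
have [_ _ _ _ hbad] := svalP (x k).
have [n _] := hbad 0%N; rewrite xk -/(al k) -/(be k); apply/negP; rewrite -leNgt.
have dsc y : cmod (sc k y) = cmod y / 2%:R ^+ k by rewrite cmodM cmodV cmodX cmod_nat.
have key (u v : R) w : 0 <= u <= 1 -> 0 <= v <= 1 ->
    w = p + (al k)%:C * d + (be k)%:C * e + u%:C * sc k d + v%:C * sc k e ->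
    cmod (F w - (F w0 - w0 * q w0 + q w0 * w)) <= s / 2%:R ^+ k * eta.
  move=> uI vI wE.
  have ww0 : cmod (w - w0) <= s / 2%:R ^+ k.
    have -> : w - w0 = (al k + u / 2%:R ^+ k - a)%:C * d + (be k + v / 2%:R ^+ k - b)%:C * e.
      rewrite wE /w0 !rmorphB !rmorphD/= !rmorphM/= !fmorphV/= !rmorphXn/= !rmorph_nat /sc.
      ring.
    apply: le_trans (cmodD _ _) _; rewrite !cmodM !cmod_real /s mulrDl.
    have := ha k; have := hb k; have P := pw0 k.
    have bd (y : R) : 0 <= y <= 1 -> 0 <= y / 2%:R ^+ k <= (2%:R ^+ k)^-1.
      by move=> /andP[y0 y1]; rewrite mulr_ge0 ?(ltW P)//= ger_pMl.
    have := bd u uI; have := bd v vI.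
    move=> /andP[v0 v1] /andP[u0 u1] /andP[b0 b1] /andP[a0 a1].
    rewrite !(mulrC (cmod _)); apply: lerD; apply: ler_wpM2r; rewrite ?cmod_ge0//.
      by rewrite ler_norml; lra.
    by rewrite ler_norml; lra.
  have -> : F w - (F w0 - w0 * q w0 + q w0 * w) = (w - w0) * (q w - q w0).
    by rewrite (FE w); ring.
  rewrite cmodM ler_pM ?cmod_ge0//; apply/ltW/hdl.
  exact: le_lt_trans ww0 hk.
apply: le_trans (par_sum_near_affine n key) _.
rewrite !dsc -mulrDl -/s.
have -> : s / 2%:R ^+ k * (s / 2%:R ^+ k * eta) *+ 2 =
    (s ^+ 2 *+ 2 * eta) / 4%:R ^+ k.
  have -> : 4%:R ^+ k = 2%:R ^+ k * 2%:R ^+ k :> R by rewrite -exprMn -natrM.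
  by field; rewrite expf_neq0.
rewrite ler_wpM2r ?invr_ge0 ?exprn_ge0// /eta mulrCA ger_pMr//.
by rewrite ler_pdivrMr// mul1r lerDl.
Qed.

End DyadicContourSums.

(** * The complex exponential *)

Section ComplexExponential.
Context (R : realType).
Implicit Types z w : R[i].

Lemma cexpD z w : cexp (z + w) = cexp z * cexp w.
Proof.
case: z w => [x y] [u v]; rewrite /cexp/= expRD cosD sinD rmorphM/=.
rewrite mulrACA; congr (_ * _).
by apply/eqP; rewrite eq_complex/=; apply/andP; split; apply/eqP; ring.
Qed.

Lemma cexp0 : cexp (0 : R[i]) = 1.
Proof. by rewrite /cexp/= expR0 cos0 sin0 mul1r. Qed.

Lemma cmod_cexp z : cmod (cexp z) = expR (complex.Re z).
Proof.
rewrite /cexp cmodM cmod_real ger0_norm ?expR_ge0// cmod_sqrt/=.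
by rewrite cos2Dsin2 sqrtr1 mulr1.
Qed.

Lemma cexp_neq0 z : cexp z != 0.
Proof. by rewrite -cmod_gt0 cmod_cexp expR_gt0. Qed.

Lemma cexpN z : cexp (- z) = (cexp z)^-1.
Proof.
apply: (mulfI (cexp_neq0 z)); rewrite mulfV ?cexp_neq0//.
by rewrite -cexpD subrr cexp0.
Qed.

Lemma cexpX z n : cexp (n%:R * z) = cexp z ^+ n.
Proof.
by elim: n => [|n IHn]; rewrite ?mul0r ?cexp0// exprS -IHn -cexpD mulrS mulrDl mul1r.
Qed.

Lemma cexp_period z : cexp (z + (0 +i* (pi *+ 2))) = cexp z.
Proof. by rewrite cexpD /cexp/= expR0 cos2pi sin2pi mulr1 rmorph1 mulr1. Qed.

Lemma derive_at0_le (f : R -> R) (c : R) : is_derive (0 : R) (1 : R) f c ->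
  forall e : R, 0 < e -> exists2 d : R, 0 < d &
    forall h, `|h| < d -> `|f h - f 0 - c * h| <= e * `|h|.
Proof.
move=> [df fc] e e0.
have F := @dnbhs_filter R 0.
have D : (fun h => h^-1 *: (f (h *: 1 + 0) - f 0)) @ 0^' --> c.
  by rewrite -fc; exact: df.
move/(@cvgrPdist_lt _ _ _ _ F) : D => /(_ _ e0)/nbhs_normP[d /= d0 hd].
exists d => // h hlt; have [->|h0] := eqVneq h 0.
  by rewrite mulr0 subr0 subrr normr0 mulr0.
have /hd/(_ h0)/= : ball_ Num.norm 0 d h by rewrite /ball_/= sub0r normrN.
rewrite /GRing.scale/= mulr1 addr0 => /ltW.
rewrite -(ler_pM2r (_ : 0 < `|h|)) ?normr_gt0// -normrM distrC mulrBl.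
by rewrite mulrAC mulVf// mul1r.
Qed.

(** By the addition formula the derivative at 0 determines the derivative everywhere; at 0 it is
    assembled from the real derivatives of exp, cos and sin. *)
Lemma cexp_quotient : exists q : R[i] -> R[i],
  [/\ ccont q 0, q 0 = 1 & forall w, cexp w = 1 + w * q w].
Proof.
exists (fun h => if h == 0 then 1 else (cexp h - 1) / h).
split; [|by rewrite eqxx|]; last first.
  move=> w; case: eqP => [->|/eqP w0]; first by rewrite cexp0 mulr1 addr0.
  by rewrite mulrC divfK// addrC subrK.
apply/ccontP => e e0; rewrite eqxx.
(* The real part will contribute [3 e' W] and the imaginary part [5 e' W], together at most half of
   [e W]. The bound 1 keeps [|x|] and [|y|] at most 1. *)
pose e' := Num.min (e / 16) 1.
have e'0 : 0 < e' by rewrite lt_min divr_gt0//=.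
have [d1 d10 h1] := derive_at0_le (is_derive_expR 0) e'0.
have [d2 d20 h2] := derive_at0_le (is_derive_cos 0) e'0.
have [d3 d30 h3] := derive_at0_le (is_derive_sin 0) e'0.
exists (Num.min e' (Num.min d1 (Num.min d2 d3))).
  by rewrite lt_min e'0 !lt_min d10 d20.
move=> w; rewrite subr0 lt_min => /andP[we]; rewrite !lt_min => /and3P[w1 w2 w3].
case: eqP => [_|/eqP w0]; first by rewrite subrr cmod0.
have -> : (cexp w - 1) / w - 1 = (cexp w - 1 - w) / w by field.
rewrite cmodM cmodV ltr_pdivrMr ?cmod_gt0//.
case: w w0 we w1 w2 w3 => x y w0 we w1 w2 w3.
have xw : `|x| <= cmod (x +i* y).
  by rewrite cmod_sqrt/= -sqrtr_sqr ler_wsqrtr// lerDl sqr_ge0.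
have yw : `|y| <= cmod (x +i* y).
  by rewrite cmod_sqrt/= -sqrtr_sqr ler_wsqrtr// lerDr sqr_ge0.
have {}h1 := h1 x (le_lt_trans xw w1).
have {}h2 := h2 y (le_lt_trans yw w2).
have {}h3 := h3 y (le_lt_trans yw w3).
move: h1 h2 h3; rewrite expR0 cos0 sin0 oppr0 mul0r !subr0 !mul1r ?addr0 => h1 h2 h3.
have e'1 : e' <= 1 by rewrite /e' ge_min lexx orbT.
have xe : `|x| <= e' by rewrite (le_trans xw)// ltW.
have ye : `|y| <= e' by rewrite (le_trans yw)// ltW.
set W := cmod _ in xw yw *.
have W0 : 0 < W by rewrite cmod_gt0.
have cosy : `|cos y| <= 1 by rewrite ler_norml cos_geN1 cos_le1.
have b1 : `|complex.Re (cexp (x +i* y) - 1 - (x +i* y))| <= (e' * W) *+ 3.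
  have -> : complex.Re (cexp (x +i* y) - 1 - (x +i* y)) =
    (expR x - 1 - x) * cos y + (1 + x) * (cos y - 1) by rewrite /cexp/=; ring.
  apply: le_trans (ler_normD _ _) _; rewrite !normrM.
  have a1 : `|expR x - 1 - x| * `|cos y| <= e' * W * 1.
    by rewrite ler_pM// (le_trans h1)// ler_pM2l.
  have a2 : `|1 + x| * `|cos y - 1| <= 2 * (e' * W).
    rewrite ler_pM//; last by rewrite (le_trans h2)// ler_pM2l.
    by apply: le_trans (ler_normD _ _) _; rewrite normr1; lra.
  by lra.
have b2 : `|complex.Im (cexp (x +i* y) - 1 - (x +i* y))| <= (e' * W) *+ 5.
  have -> : complex.Im (cexp (x +i* y) - 1 - (x +i* y)) =
    (expR x - 1 - x + x) * sin y + (sin y - y) by rewrite /cexp/=; ring.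
  apply: le_trans (ler_normD _ _) _; rewrite !normrM.
  have h1' : `|expR x - 1 - x| <= 1 * `|x| by rewrite (le_trans h1)// ler_wpM2r.
  have a1 : `|expR x - 1 - x + x| <= 2 * e'.
    by apply: le_trans (ler_normD _ _) _; lra.
  have a2 : `|sin y| <= 2 * W.
    rewrite -[sin y](subrK y); apply: le_trans (ler_normD _ _) _.
    have : e' * `|y| <= 1 * `|y| by rewrite ler_wpM2r.
    by lra.
  have a3 : `|expR x - 1 - x + x| * `|sin y| <= 2 * e' * (2 * W) by rewrite ler_pM.
  have a4 : `|sin y - y| <= e' * W by rewrite (le_trans h3)// ler_pM2l.
  by lra.
apply: le_lt_trans (cmod_le_ReIm _) _.
have e'e : e' * W <= e / 16 * W by rewrite ler_pM2r// /e' ge_min lexx.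
have : 0 < e * W by rewrite mulr_gt0.
by lra.
Qed.

Lemma cdiff_cexp z : cdiff (@cexp R) z.
Proof.
have [q [qc q0 qE]] := cexp_quotient.
exists (fun w => cexp z * q (w - z)).
  apply: contM; first exact: cont_cst.
  apply: (@cont_comp _ (fun w => w - z)); last by rewrite subrr.
  exact: contB (cont_id _) (cont_cst _ _).
move=> w; rewrite -{1}[w](subrK z) cexpD qE; ring.
Qed.

End ComplexExponential.

(** * The maximum principle and Cauchy's estimate *)

Section MaximumPrinciple.
Context (R : realType).
Implicit Types (F G : R[i] -> R[i]) (z w : R[i]).

Lemma seg_sum_cst (c : R[i]) n p d : seg_sum (fun=> c) n p d = d * c.
Proof.
have n0 := pow2C_neq0 R n.
by rewrite /seg_sum sumr_const card_ord -[_ *+ (2 ^ n)]mulr_natl natrX; field.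
Qed.

Lemma seg_sumB F G n p d :
  seg_sum (fun w => F w - G w) n p d = seg_sum F n p d - seg_sum G n p d.
Proof. by rewrite /seg_sum sumrB mulrBr. Qed.

(* Goursat for [w |-> G (z0 + exp w)] on a period rectangle: the means of [G]
   over two circles around [z0] agree asymptotically, and the small circle
   gives [G z0]. *)
Lemma max_principle G z0 (r M : R) : 0 < r -> ccont G z0 ->
  (forall w, 0 < cmod (w - z0) <= r -> cdiff G w) ->
  (forall w, cmod (w - z0) = r -> cmod (G w) <= M) ->
  cmod (G z0) <= M.
Proof.
move=> r0 /ccontP cG dG GM; apply/ler_addgt0Pr => e e0.
have [dl dl0 hdl] := cG (e / 2) (divr_gt0 e0 (ltr0n _ 2)).
pose rho := Num.min (dl / 2) r.
have rho0 : 0 < rho by rewrite lt_min divr_gt0.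
have rhor : rho <= r by rewrite ge_min lexx orbT.
have rhodl : rho < dl by rewrite gt_min; apply/orP; left; lra.
(* [cexp] omits 0, so [F] never meets the centre [z0], where [G] is only assumed continuous. The
   rectangle from [ln rho] to [ln r], of height one period, covers the annulus between the two
   circles. *)
pose F w := G (z0 + cexp w).
pose p : R[i] := (ln rho)%:C.
pose d : R[i] := (ln r - ln rho)%:C.
pose per : R[i] := 0 +i* (pi *+ 2).
have lnle : ln rho <= ln r by rewrite ler_ln.
have dF (s t : R) : 0 <= s <= 1 -> 0 <= t <= 1 -> cdiff F (p + s%:C * d + t%:C * per).
  move=> /andP[s0 s1] tI.
  apply: (@cdiff_comp _ (fun w => z0 + cexp w) G).
    exact: cdiffD (cdiff_cst _ _) (cdiff_cexp _).
  apply: dG; rewrite addrC addKr cmod_cexp expR_gt0/=.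
  rewrite -[leRHS]lnK ?posrE// ler_expR/= mul0r subr0 mulr0 mul0r !subr0 addr0.
  have : s * (ln r - ln rho) <= 1 * (ln r - ln rho) by rewrite ler_wpM2r// subr_ge0.
  lra.
have pi0 : 0 < pi *+ 2 :> R by rewrite mulrn_wgt0// pi_gt0.
have cper : cmod per = pi *+ 2.
  by rewrite cmod_sqrt/= expr0n add0r sqrtr_sqr ger0_norm// ltW.
have [m /(_ m (leqnn m))] := goursat dF (mulr_gt0 pi0 (divr_gt0 e0 (ltr0n _ 2))).
(* The two sides parallel to [d] are a period of [cexp] apart and cancel. *)
have -> : par_sum F m p d per = seg_sum F m (p + d) per - seg_sum F m p per.
  rewrite /par_sum [X in _ + _ - X - _](_ : _ = seg_sum F m p d); first ring.
  rewrite /seg_sum; congr (_ * _); apply: eq_bigr => k _.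
  by rewrite /F addrAC cexp_period.
set H1 := seg_sum _ _ _ _; set H2 := seg_sum _ _ _ _ => Hpar.
have circ (rr t : R) : 0 < rr -> cmod (cexp ((ln rr)%:C + t%:C * per)) = rr.
  by move=> rr0; rewrite cmod_cexp/= mul0r mulr0 subr0 addr0 lnK.
have b1 : cmod H1 <= pi *+ 2 * M.
  rewrite -cper; apply: seg_sum_le => t _; apply: GM.
  rewrite (_ : p + d = (ln r)%:C); last by rewrite -rmorphD/= addrC subrK.
  by rewrite addrC addKr circ.
have b2 : cmod (H2 - per * G z0) <= pi *+ 2 * (e / 2).
  rewrite -(seg_sum_cst (G z0) m p per) -seg_sumB -cper.
  apply: seg_sum_le => t _; apply/ltW/hdl.
  by rewrite addrC addKr circ.
have : cmod (per * G z0) <= pi *+ 2 * (M + e).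
  have -> : per * G z0 = H1 - (H1 - H2) - (H2 - per * G z0) by ring.
  apply: le_trans (cmodB _ _) _.
  apply: le_trans (lerD (cmodB _ _) (lexx _)) _.
  rewrite (_ : pi *+ 2 * (M + e) =
    pi *+ 2 * M + pi *+ 2 * (e / 2) + pi *+ 2 * (e / 2)); last by field.
  exact: lerD (lerD b1 Hpar) b2.
by rewrite cmodM cper ler_pM2l.
Qed.

(* Cauchy's estimate, as the maximum principle for the difference quotient. *)
Lemma cauchy_estimate G z (r M : R) : 0 < r -> entire G ->
  (forall w, cmod (w - z) = r -> cmod (G w) <= M) ->
  cmod (derive1 G z) <= M *+ 2 / r.
Proof.
move=> r0 eG GM; have dG w := entire_cdiff w eG.
have [q [qc GE <-]] := derivable_cdiff (eG z).
have GzM : cmod (G z) <= M by apply: max_principle r0 (cdiff_cont (dG z)) _ GM.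
have qE w : w != z -> q w = (G w - G z) / (w - z).
  by move=> wz; rewrite (GE w); field; rewrite subr_eq0.
apply: (max_principle r0 qc) => [w /andP[w0 _]|w wr]; last first.
  have wz : w != z by rewrite -subr_eq0 -cmod_gt0 wr.
  rewrite qE// cmodM cmodV wr ler_wpM2r ?invr_ge0 ?(ltW r0)//.
  by rewrite mulr2n (le_trans (cmodB _ _))// lerD// GM.
have wz : w - z != 0 by rewrite -cmod_gt0.
apply: (@cdiff_eq_near _ (fun w => (G w - G z) / (w - z)) _ _ (cmod (w - z))) => //.
  move=> u uw; rewrite qE//; apply: contraTneq uw => ->.
  by rewrite cmodBC ltxx.
apply: cdiffM; first exact: cdiffB (dG w) (cdiff_cst _ _).
by apply: cdiffV => //; exact: cdiffB (cdiff_id _) (cdiff_cst _ _).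
Qed.

End MaximumPrinciple.

(** * Liouville's theorem for polynomial growth *)

Section Liouville.
Context (R : realType).
Implicit Types (G : R[i] -> R[i]) (z w : R[i]) (S : seq R[i]).

(** The constants disappear under m-th roots as m grows; Bernoulli's inequality for [x / y] takes
    the place of the roots. *)
Lemma le_of_pow_le (x y c K : R) : 0 <= y -> 0 < c ->
  (forall m, c * x ^+ m <= K * y ^+ m) -> x <= y.
Proof.
move=> y0 c0 h; rewrite leNgt; apply/negP => yx.
have [yE|yn0] := eqVneq y 0.
  by have := h 1%N; rewrite yE !expr1 mulr0 pmulr_rle0// leNgt -yE yx.
have yp : 0 < y by rewrite lt0r yn0.
pose t := x / y.
have t1 : 0 < t - 1 by rewrite subr_gt0 ltr_pdivlMr// mul1r.
have bern m : 1 + m%:R * (t - 1) <= t ^+ m.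
  elim: m => [|m IH]; first by rewrite mul0r addr0.
  have m0 : 0 <= m%:R * (t - 1) ^+ 2 :> R by rewrite mulr_ge0 ?sqr_ge0.
  rewrite exprS -natr1.
  have : t * (1 + m%:R * (t - 1)) <= t * t ^+ m by rewrite ler_wpM2l//; lra.
  by apply: le_trans; move: m0; nra.
have tK m : t ^+ m <= K / c.
  rewrite ler_pdivlMr// mulrC expr_div_n mulrA ler_pdivrMr ?exprn_gt0//.
have K0 : 0 <= K / c by apply: le_trans (tK 0%N).
have := archi_boundP (divr_ge0 K0 (ltW t1)); set m := Num.Def.archi_bound _.
rewrite ltr_pdivrMr// => hm.
by have := le_trans (bern m) (tK m); rewrite leNgt => /negP; apply; lra.
Qed.

(* The maximum principle for [G ^ m * prod (w - s)], which is differentiable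
   also at the points of [S], for m -> oo. *)
Lemma max_principle_except S G z0 (r M : R) : 0 < r -> z0 \notin S ->
  (forall w, ccont G w) -> (forall w, w \notin S -> cdiff G w) ->
  (forall w, cmod (w - z0) = r -> cmod (G w) <= M) ->
  cmod (G z0) <= M.
Proof.
move=> r0 z0S cG dG GM.
pose P w := \prod_(s <- S) (w - s).
have dP w : cdiff P w by apply: cdiff_prod => s; exact: cdiffB (cdiff_id _) (cdiff_cst _ _).
have cX m w : ccont (fun u => G u ^+ m) w.
  elim: m => [|m IH]; first exact: cont_cst.
  under eq_fun do rewrite exprS; exact: contM.
have dH m w : cdiff (fun u => P u * G u ^+ m) w.
  have [wS|wS] := boolP (w \in S); last first.
    by apply: cdiffM => //; apply: cdiffX; exact: dG.
  have [q qc PE] := dP w.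
  have P0 : P w = 0 by apply/eqP; rewrite prodf_seq_eq0; apply/hasP; exists w; rewrite ?subrr/=.
  (* As [P w = 0], the factor [u - w] comes out of [P], and continuity of [G] suffices for the
     cofactor. *)
  exists (fun u => q u * G u ^+ m); first exact: contM.
  by move=> u; rewrite (PE u) P0; ring.
have M0 : 0 <= M.
  by apply: le_trans (GM (z0 + r%:C) _); rewrite ?cmod_ge0// addrC addKr cmod_real ger0_norm ?ltW.
pose K : R := \prod_(s <- S) (r + cmod (z0 - s)).
apply: (@le_of_pow_le _ _ (cmod (P z0)) K) => //.
  rewrite cmod_gt0 prodf_seq_neq0; apply/allP => s sS /=.
  by rewrite subr_eq0; apply: contraNneq z0S => ->.
move=> m; rewrite -cmodX -cmodM.
apply: (max_principle (G := fun u => P u * G u ^+ m) r0 (cdiff_cont (dH m z0))) => // w wr.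
rewrite cmodM cmodX ler_pM ?cmod_ge0 ?exprn_ge0 ?cmod_ge0//; last first.
  by rewrite lerXn2r ?nnegrE ?cmod_ge0 ?GM.
rewrite /P cmod_prod; apply: ler_prod => s _; rewrite cmod_ge0/= -wr.
by rewrite -[w - s](subrKA z0) cmodD.
Qed.

Lemma fresh_point S : exists w : R[i], w \notin S.
Proof.
have [B hB] : exists B : R, forall s, s \in S -> cmod s < B.
  elim: S => [|x S [B hB]]; first by exists 0.
  exists (Num.max B (cmod x + 1)) => s; rewrite inE => /orP[/eqP ->|/hB sB].
    by rewrite lt_max ltrDl ltr01 orbT.
  by rewrite lt_max sB.
exists B%:C; apply/negP => /hB; rewrite cmod_real => /(le_lt_trans (ler_norm _)).
by rewrite ltxx.
Qed.

(** Induction on the degree: the difference quotient of [G] at a point [p] outside [S] grows one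
    degree slower, but at [p] it is only known to be continuous. Hence the finite exceptional set
    [S], which gains a point at each step. For [N = 0] the quotient tends to 0 at infinity and so
    vanishes by the maximum principle. *)
Lemma liouville_poly S G N (C r0 : R) : 1 <= r0 ->
  (forall w, ccont G w) -> (forall w, w \notin S -> cdiff G w) ->
  (forall w, r0 <= cmod w -> cmod (G w) <= C * cmod w ^+ N) ->
  exists p : {poly R[i]}, forall w, w \notin S -> G w = p.[w].
Proof.
elim: N S G C r0 => [|N IH] S G C r0 r01 cG dG GC.
all: have [p pS] := fresh_point S; have [q qc GE] := dG p pS.
all: have qE w : w != p -> q w = (G w - G p) / (w - p) by
  move=> wp; rewrite (GE w); field; rewrite subr_eq0.
all: have near w : w != p -> forall u, cmod (u - w) < cmod (w - p) -> (G u - G p) / (u - p) = q u by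
  move=> wp u uw; rewrite qE//; apply: contraTneq uw => ->; rewrite cmodBC ltxx.
all: have wp0 w : w != p -> 0 < cmod (w - p) by move=> wp; rewrite cmod_gt0 subr_eq0.
all: have cq w : ccont q w.
  1,3: have [->//|wp] := eqVneq w p.
  1,2: apply: cont_eq_near (wp0 w wp) (near w wp) _.
  1,2: apply: contM; first exact: contB (cG w) (cont_cst _ _).
  1,2: by apply: contV; rewrite ?subr_eq0//; exact: contB (cont_id _) (cont_cst _ _).
all: have dq w : w \notin p :: S -> cdiff q w.
  1,3: rewrite inE negb_or => /andP[wp wS].
  1,2: apply: cdiff_eq_near (wp0 w wp) (near w wp) _.
  1,2: apply: cdiffM; first exact: cdiffB (dG w wS) (cdiff_cst _ _).
  1,2: by apply: cdiffV; rewrite ?subr_eq0//; exact: cdiffB (cdiff_id _) (cdiff_cst _ _).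
all: have far w : Num.max r0 (cmod p *+ 2) <= cmod w -> w != p /\ cmod w / 2 <= cmod (w - p).
  1,3: rewrite ge_max => /andP[wr wp].
  1,2: have h : cmod w / 2 <= cmod (w - p) by
    have := cmodD (w - p) p; rewrite subrK; lra.
  1,2: by split => //; rewrite -subr_eq0 -cmod_gt0; lra.
- exists (G p)%:P => w wS; rewrite hornerC.
  have [->//|wp] := eqVneq w p.
  suff q0 : q w = 0 by rewrite (GE w) q0 mulr0 addr0.
  apply/eqP; rewrite -cmod_eq0 eq_le cmod_ge0 andbT.
  apply/ler_addgt0Pr => e e0; rewrite add0r.
  pose K := `|C| + cmod (G p).
  have K0 : 0 <= K by rewrite addr_ge0 ?cmod_ge0.
  (* Every point [x] of the circle of radius [r] about [w] has [|x| >= r - |w|], so [far] applies to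
     it and [|x| >= 2 K / e]; thus [|q x| <= e]. *)
  pose r := cmod w + Num.max r0 (cmod p *+ 2) + K * 2 / e.
  have Ke : 0 <= K * 2 / e by rewrite mulr_ge0 ?invr_ge0 ?(ltW e0)// mulr_ge0.
  have mx : r0 <= Num.max r0 (cmod p *+ 2) by rewrite le_max lexx.
  have r_gt0 : 0 < r by rewrite /r; have := cmod_ge0 w; lra.
  apply: (@max_principle_except (p :: S) q w r e r_gt0) => //.
    by rewrite inE negb_or wp.
  move=> x xr.
  have xw : r - cmod w <= cmod x by have := cmodB x w; rewrite xr; lra.
  have xmx : Num.max r0 (cmod p *+ 2) <= cmod x by move: xw; rewrite /r; lra.
  have [xp xh] := far x xmx.
  have xr0 : r0 <= cmod x by exact: le_trans mx xmx.
  rewrite qE// cmodM cmodV ler_pdivrMr ?wp0//.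
  have GxK : cmod (G x - G p) <= K.
    apply: le_trans (cmodB _ _) _; rewrite lerD// (le_trans (GC x xr0))//.
    by rewrite expr0 mulr1 ler_norm.
  apply: (le_trans GxK).
  have : K * 2 / e <= cmod x by move: xw; rewrite /r; lra.
  rewrite ler_pdivrMr// => h.
  have : e * (cmod x / 2) <= e * cmod (x - p) by rewrite ler_pM2l.
  by apply: le_trans; lra.
- have [P PE] : exists P : {poly R[i]}, forall w, w \notin p :: S -> q w = P.[w].
    apply: (IH (p :: S) q ((`|C| + cmod (G p)) * 2) (Num.max r0 (cmod p *+ 2))) => //.
      by rewrite le_max r01.
    move=> w wr; have [wp wh] := far w wr.
    have wr0 : r0 <= cmod w by move: wr; rewrite ge_max => /andP[].
    have w1 : 1 <= cmod w by exact: le_trans r01 wr0.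
    rewrite qE// cmodM cmodV ler_pdivrMr ?wp0//.
    apply: le_trans (cmodB _ _) _.
    have b1 : cmod (G w) <= `|C| * cmod w ^+ N.+1.
      by apply: le_trans (GC w wr0) _; rewrite ler_wpM2r ?exprn_ge0 ?cmod_ge0 ?ler_norm.
    have b2 : cmod (G p) <= cmod (G p) * cmod w ^+ N.+1.
      by rewrite ler_peMr ?cmod_ge0// exprn_ege1.
    apply: le_trans (lerD b1 b2) _; rewrite -mulrDl exprSr.
    have K0 : 0 <= `|C| + cmod (G p) by rewrite addr_ge0 ?cmod_ge0.
    have wN0 : 0 <= cmod w ^+ N by rewrite exprn_ge0 ?cmod_ge0.
    have := ler_wpM2l (mulr_ge0 K0 wN0) wh.
    by lra.
  exists ((G p)%:P + ('X - p%:P) * P) => w wS.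
  rewrite hornerD hornerM hornerC !hornerE (GE w).
  have [->|wp] := eqVneq w p; first by rewrite subrr !mul0r.
  by rewrite PE// inE negb_or wp.
Qed.

End Liouville.

(** * Independence of exponentials over polynomials, and identification of the solution *)

Section ExponentialPolynomials.
Context (R : realType).
Implicit Types (f : R[i] -> R[i]) (z w : R[i]) (A B p : {poly R[i]}).

Lemma poly_eq0_inj_roots p (x : nat -> R[i]) : injective x ->
  (forall n, p.[x n] = 0) -> p = 0.
Proof.
move=> xi px; apply: (@roots_geq_poly_eq0 _ p [seq x n | n <- iota 0 (size p)]).
- by apply/allP => _ /mapP[n _ ->]; apply/rootP.
- by rewrite map_inj_uniq ?iota_uniq.
- by rewrite size_map size_iota.
Qed.

(* exp (a z) takes the values 1 and -1 at infinitely many points. *)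
Lemma exp_poly_indep (a : R[i]) A B : a != 0 ->
  (forall z, cexp (a * z) * A.[z] + B.[z] = 0) -> A = 0 /\ B = 0.
Proof.
move=> a0 AB.
pose per : R[i] := 0 +i* (pi *+ 2); pose hp : R[i] := 0 +i* pi.
have per0 : per != 0.
  by rewrite eq_complex/= eqxx/= mulrn_eq0/= gt_eqF// pi_gt0.
have E1 n : cexp (n%:R * per) = 1.
  by rewrite cexpX -[per]add0r cexp_period cexp0 expr1n.
have E2 : cexp hp = -1.
  by rewrite /cexp/= expR0 cospi sinpi mul1r; apply/eqP; rewrite eq_complex/= oppr0 !eqxx.
have inj c : injective (fun n : nat => (n%:R * per + c) / a).
  move=> m n /(mulIf (_ : a^-1 != 0)); rewrite invr_eq0 => /(_ a0)/addIr/(mulIf per0)/eqP.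
  by rewrite eqr_nat => /eqP.
have h1 : A + B = 0.
  apply: (poly_eq0_inj_roots (inj 0)) => n.
  by have := AB ((n%:R * per + 0) / a); rewrite [a * _]mulrC divfK// addr0 E1 mul1r hornerD.
have h2 : B - A = 0.
  apply: (poly_eq0_inj_roots (inj hp)) => n.
  have := AB ((n%:R * per + hp) / a); rewrite [a * _]mulrC divfK// cexpD E1 E2 mul1r mulN1r.
  by rewrite hornerD hornerN addrC.
have B0 : B *+ 2 = 0 by rewrite mulr2n -{1}[B](subrK A) h2 add0r.
have {}B0 : B = 0.
  apply/polyP => i; have := congr1 (fun p : {poly R[i]} => p`_i) B0.
  by rewrite coefMn coef0 => /eqP; rewrite mulrn_eq0/= => /eqP.
by move: h1; rewrite B0 addr0.
Qed.

Lemma derive1_unique f z (q : R[i] -> R[i]) : derivable f z 1 -> ccont q z ->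
  (forall w, f w = f z + (w - z) * q w) -> derive1 f z = q z.
Proof.
move=> /derivable_cdiff[q' [/ccontP q'c fE' <-]] /ccontP qc fE.
apply/eqP; rewrite -subr_eq0 -cmod_eq0 eq_le cmod_ge0 andbT.
apply/ler_addgt0Pr => e e0; rewrite add0r.
have [d1 d10 h1] := q'c _ (divr_gt0 e0 (ltr0n _ 2)).
have [d2 d20 h2] := qc _ (divr_gt0 e0 (ltr0n _ 2)).
pose d := Num.min d1 d2 / 2.
have d0 : 0 < d by rewrite divr_gt0// lt_min d10.
have dlt : d < Num.min d1 d2 by move: d0; rewrite /d; lra.
have zd : z + d%:C - z = d%:C by rewrite addrC addKr.
have dC : cmod d%:C = d by rewrite cmod_real gtr0_norm.
have qq : q' (z + d%:C) = q (z + d%:C).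
  have := fE' (z + d%:C); rewrite (fE (z + d%:C)) zd => /addrI/mulfI ->//.
  by rewrite -cmod_gt0 dC.
have := h1 (z + d%:C); have := h2 (z + d%:C); rewrite zd dC qq.
move: dlt; rewrite lt_min => /andP[l1 l2] /(_ l2) g2 /(_ l1) g1.
rewrite (_ : q' z - q z = (q (z + d%:C) - q z) - (q (z + d%:C) - q' z)); last ring.
by apply: le_trans (cmodB _ _) _; lra.
Qed.

Lemma derive1_exp_poly f (c al : R[i]) p z : derivable f z 1 ->
  (forall w, f w = c * cexp (al * w) + p.[w]) ->
  derive1 f z = c * (al * cexp (al * z)) + p^`().[z].
Proof.
move=> df fE.
have [q [qc q0 qE]] := cexp_quotient R.
have /factor_theorem[s sE] : root (p - p.[z]%:P) z.
  by apply/rootP; rewrite hornerD hornerN hornerC subrr.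
have ps w : p.[w] = p.[z] + (w - z) * s.[w].
  have := congr1 (fun P : {poly R[i]} => P.[w]) sE.
  by rewrite hornerM !hornerE => /eqP; rewrite subr_eq => /eqP ->; ring.
have ps' : p^`().[z] = s.[z].
  have := congr1 (fun P : {poly R[i]} => P^`().[z]) sE.
  rewrite derivB derivC subr0 derivM derivXsubC mulr1.
  by rewrite hornerD hornerM hornerXsubC subrr mulr0 add0r.
pose Q w := c * (al * cexp (al * z)) * q (al * (w - z)) + s.[w].
rewrite (_ : _ + _ = Q z); last by rewrite /Q subrr mulr0 q0 mulr1 ps'.
apply: (@derive1_unique f z Q df).
  apply: contD; last exact/cdiff_cont/cdiff_poly.
  apply: contM; first exact: cont_cst.
  apply: (@cont_comp _ (fun w => al * (w - z))); last by rewrite subrr mulr0.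
  exact: contM (cont_cst _ _) (contB (cont_id _) (cont_cst _ _)).
move=> w; rewrite !fE (ps w) /Q.
have -> : cexp (al * w) = cexp (al * z) * cexp (al * (w - z)).
  by rewrite -cexpD; congr cexp; ring.
by rewrite (qE (al * (w - z))); ring.
Qed.

Lemma exp_poly_solution (g h u v : {poly R[i]}) (a b eta c : R[i]) f p :
  a != 0 -> b != 0 -> entire f ->
  (exists z, Lop g h u v eta f z != 0) ->
  (forall z, f z ^+ 2 + Lop g h u v eta f z = b * cexp (a * z)) ->
  c ^+ 2 = b -> (forall z, f z = c * cexp (a / 2 * z) + p.[z]) ->
  p = - 2^-1 *: (cexp (a * eta / 2) *: g + (a / 2) *: h + u) /\ p != 0.
Proof.
move=> a0 b0 ef [z1 Lz1] feq cb fE.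
have c0 : c != 0 by apply: contraNneq b0 => c0; rewrite -cb c0 expr0n.
have a20 : a / 2 != 0 by rewrite mulf_neq0// invr_eq0 pnatr_eq0.
have sqE z : cexp (a * z) = cexp (a / 2 * z) ^+ 2.
  by rewrite -cexpX; congr cexp; field.
(* With [E = cexp (a / 2 * z)], the [E ^ 2] terms cancel by [c ^ 2 = b]. The coefficient of [E] is
   [c (2 p + G)], the shift contributing [cexp (a * eta / 2)] and the derivative [a / 2]; [B] is the
   part free of [E]. *)
pose G := cexp (a * eta / 2) *: g + (a / 2) *: h + u.
pose B := p ^+ 2 + g * (p \Po ('X + eta%:P)) + h * p^`() + u * p + v.
have [/eqP A0 _] : c *: (p *+ 2 + G) = 0 /\ B = 0.
  apply: (exp_poly_indep a20) => z.
  have := feq z; rewrite /Lop (derive1_exp_poly (ef z) fE) (fE z) (fE (z + eta)) sqE -cb.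
  have -> : cexp (a / 2 * (z + eta)) = cexp (a / 2 * z) * cexp (a * eta / 2).
    by rewrite -cexpD; congr cexp; field.
  rewrite /B /G; move: (cexp (a / 2 * z)) (cexp (a * eta / 2)) => X Y.
  move/eqP; rewrite -subr_eq0 => /eqP E; rewrite -[RHS]E.
  rewrite mulr2n.
  rewrite !(hornerD, hornerM, hornerZ, horner_comp, horner_exp, hornerX, hornerC).
  ring.
have pE : p = - 2^-1 *: G.
  move: A0; rewrite scaler_eq0 (negbTE c0)/= addr_eq0 => /eqP h2.
  by rewrite scaleNr -scalerN -h2 -[p *+ 2]scaler_nat scalerA mulVf ?pnatr_eq0// scale1r.
split => //; apply: contraNneq Lz1 => p0.
have := feq z1; rewrite (fE z1) p0 horner0 addr0 exprMn cb -sqE.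
by move=> /eqP; rewrite -[X in _ == X]addr0 (inj_eq (addrI _)).
Qed.

End ExponentialPolynomials.

(** * From an asymptotic square root to an exponential plus a polynomial *)

Section Asymptotics.
Context (R : realType).
Implicit Types (f : R[i] -> R[i]) (z w : R[i]).

(** In [exp_plus_poly] a margin [expR (x / 2)] is split evenly between powers of [1 + x] and of
    [1 + |y|], whence the rate [x / 4]. The surplus power in [N.+1] serves to absorb a constant. *)
Lemma expr_le_expR N : exists2 K : R, 0 < K &
  forall x, 0 <= x -> (1 + x) ^+ N.+1 <= K * expR (x / 4).
Proof.
have k0 : 0 < 4 * N.+1%:R :> R by rewrite mulr_gt0.
have k1 : 1 <= N.+1%:R :> R by rewrite ler1n.
exists ((4 * N.+1%:R) ^+ N.+1); first by rewrite exprn_gt0.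
move=> x x0.
have -> : expR (x / 4) = expR (x / (4 * N.+1%:R)) ^+ N.+1.
  rewrite -expRM_natl; congr expR.
  by move: (N.+1%:R : R) k1 => k k1; field; lra.
rewrite -exprMn lerXn2r ?nnegrE ?addr_ge0 ?mulr_ge0 ?expR_ge0 ?ler0n//.
apply: le_trans (ler_wpM2l (ltW k0) (expR_ge1Dx _)).
move: (N.+1%:R : R) k0 k1 => k k0 k1.
have -> : 4 * k * (1 + x / (4 * k)) = 4 * k + x by field; lra.
lra.
Qed.

Lemma ln1D_lipschitz (x y : R) : `|ln (1 + `|x|) - ln (1 + `|y|)| <= `|x - y|.
Proof.
have H (u v : R) : 0 <= u -> 0 <= v -> ln (1 + u) - ln (1 + v) <= `|u - v|.
  move=> u0 v0.
  have v1 : 0 < 1 + v by lra.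
  rewrite -ln_div ?posrE; [|lra|lra].
  have -> : (1 + u) / (1 + v) = 1 + (u - v) / (1 + v) by field; rewrite gt_eqF.
  have q0 : -1 < (u - v) / (1 + v) by rewrite ltr_pdivlMr// ; lra.
  apply: le_trans (le_ln1Dx q0) _; apply: le_trans (ler_norm _) _.
  rewrite normrM ler_piMr// normfV invf_le1 ?normr_gt0 ?gt_eqF//.
  by rewrite ger0_norm; lra.
have A := H `|x| `|y| (normr_ge0 _) (normr_ge0 _).
have B := H `|y| `|x| (normr_ge0 _) (normr_ge0 _).
rewrite (distrC `|y| `|x|) in B.
have dxy := ler_dist_dist x y.
by rewrite ler_norml; apply/andP; split; lra.
Qed.

(** This carries the choice of a square root along a path: by the intermediate value theorem a real
    part that does not vanish keeps its sign. *)
Lemma Re_sign_const (Q : R[i] -> R[i]) (gam : R -> R[i]) (K : R) :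
  (forall w, ccont Q w) ->
  (forall s t, cmod (gam s - gam t) <= K * `|s - t|) ->
  (forall t, 0 <= t <= 1 -> complex.Re (Q (gam t)) != 0) ->
  0 < complex.Re (Q (gam 0)) -> 0 < complex.Re (Q (gam 1)).
Proof.
move=> cQ gK Qn0 Q0; rewrite ltNge; apply/negP => Q1.
pose phi t := complex.Re (Q (gam t)).
have cphi : continuous phi.
  move=> t; apply/cvgrPdist_lt => e e0.
  have /ccontP/(_ e e0)[d d0 hd] := cQ (gam t).
  have K0 : 0 < `|K| + 1 by rewrite ltr_wpDl.
  apply/nbhs_normP; exists (d / (`|K| + 1)) => /=; first by rewrite divr_gt0.
  move=> s; rewrite /ball_/= ltr_pdivlMr// => std.
  have /hd : cmod (gam s - gam t) < d.
    apply: le_lt_trans (gK _ _) _; apply: le_lt_trans std; rewrite distrC mulrC.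
    by rewrite ler_wpM2l// (le_trans (ler_norm _))// lerDl.
  apply: le_lt_trans; rewrite distrC.
  have -> : phi s - phi t = complex.Re (Q (gam s) - Q (gam t)).
    by rewrite /phi; case: (Q _) => ? ?; case: (Q _).
  by case: (_ - _) => x y; rewrite cmod_sqrt/= -sqrtr_sqr ler_wsqrtr// lerDl sqr_ge0.
have [||t + tE] := @IVT R phi 0 1 0 ler01.
- exact: continuous_subspaceT.
- by rewrite ge_min le_max Q1 (ltW Q0) orbT.
by rewrite in_itv/= => /Qn0; rewrite -/(phi t) tE eqxx.
Qed.

(* In the region Re (a z) >= kappa (Im (a z)), the quotient of f by
   E = exp (a z / 2) has square close to b, hence stays near one fixed square
   root c of b; there f - c E = (f ^ 2 - b E ^ 2) / (f + c E) has polynomial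
   growth.  Outside of the region E itself has polynomial growth. *)
Lemma exp_plus_poly f (a b : R[i]) (C : R) (N : nat) : a != 0 -> b != 0 ->
  (forall z, cdiff f z) ->
  (forall z, cmod (f z) <=
    C * (1 + cmod z) ^+ N * expR (Num.max 0 (complex.Re (a * z)) / 2)) ->
  (forall z, cmod (f z ^+ 2 - b * cexp (a * z)) <=
    C * (1 + cmod z) ^+ N * expR (Num.max 0 (complex.Re (a * z)) / 2)) ->
  exists2 c, c ^+ 2 = b &
    exists p : {poly R[i]}, forall z, f z = c * cexp (a / 2 * z) + p.[z].
Proof.
move=> a0 b0 df fC LC.
pose E z := cexp (a / 2 * z).
have E0 z : E z != 0 by exact: cexp_neq0.
have sqE z : cexp (a * z) = E z ^+ 2 by rewrite -cexpX; congr cexp; field.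
have cE z : cmod (E z) = expR (complex.Re (a * z) / 2).
  rewrite cmod_cexp; congr expR.
  have -> : a / 2 * z = (2^-1)%:C * (a * z) by rewrite fmorphV/= rmorph_nat; field.
  by case: (a * z) => x y /=; field.
have dE z : cdiff E z.
  apply: (@cdiff_comp _ (fun w => a / 2 * w)); last exact: cdiff_cexp.
  exact: cdiffM (cdiff_cst _ _) (cdiff_id _).
have C0 : 0 <= C.
  have := fC 0; rewrite cmod0 addr0 expr1n mulr1 mulr0 maxxx mul0r expR0 mulr1.
  exact/le_trans/cmod_ge0.
have a_gt0 : 0 < cmod a by rewrite cmod_gt0.
have b_gt0 : 0 < cmod b by rewrite cmod_gt0.
have [K1 K10 hK1] := expr_le_expR N.
pose K := 1 + (cmod a)^-1.
have ai0 : 0 < (cmod a)^-1 by rewrite invr_gt0.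
have K0 : 0 < K by rewrite /K; lra.
have zK z : 1 + cmod z <= K * ((1 + `|complex.Re (a * z)|) * (1 + `|complex.Im (a * z)|)).
  have : cmod z <= (cmod a)^-1 * (`|complex.Re (a * z)| + `|complex.Im (a * z)|).
    by rewrite -[leLHS](mulKf (lt0r_neq0 a_gt0)) -cmodM ler_pM2l// cmod_le_ReIm.
  have := normr_ge0 (complex.Re (a * z)); have := normr_ge0 (complex.Im (a * z)).
  move: `|_| `|_| => y x y0 x0 h; apply: (le_trans (lerD (lexx 1) h)).
  have xy := mulr_ge0 x0 y0.
  have := mulr_ge0 (ltW ai0) xy.
  by rewrite /K; lra.
clearbody K.
(* Exactly what gives [C K ^ N K1 <= (|b| / 2) (1 + x)] for [x >= X0]. *)
pose X0 := C * K ^+ N * K1 * 2 / cmod b.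
have KN0 : 0 <= C * K ^+ N by rewrite mulr_ge0// exprn_ge0// ltW.
have X00 : 0 <= X0.
  by rewrite /X0 divr_ge0 ?(ltW b_gt0)// mulr_ge0// mulr_ge0// ltW.
have X0b : X0 * cmod b = C * K ^+ N * K1 * 2 by rewrite /X0 divfK// lt0r_neq0.
clearbody X0.
(* The condition [x >= kap y] yields both [expR (x / 4) >= (1 + |y|) ^ N] and [x >= X0]. *)
pose kap (y : R) := (4 * N%:R) * ln (1 + `|y|) + X0.
have kap0 y : 0 <= kap y.
  by rewrite addr_ge0// mulr_ge0// ln_ge0// lerDl.
have kapE y : expR (kap y / 4) = (1 + `|y|) ^+ N * expR (X0 / 4).
  have y1 : 0 < 1 + `|y| by rewrite ltr_wpDr.
  rewrite /kap mulrDl expRD; congr (_ * _).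
  rewrite -[RHS](lnK (exprn_gt0 _ y1)) lnXn//; congr expR.
  by rewrite -mulr_natl; field.
pose D z := kap (complex.Im (a * z)) <= complex.Re (a * z).
have Dsmall z : D z -> cmod (f z ^+ 2 / E z ^+ 2 - b) <= cmod b / 2.
  rewrite /D => zD; set x := complex.Re _ in zD; set y := complex.Im _ in zD.
  have x0 : 0 <= x := le_trans (kap0 y) zD.
  have -> : f z ^+ 2 / E z ^+ 2 - b = (f z ^+ 2 - b * cexp (a * z)) / E z ^+ 2.
    by rewrite sqE; field.
  rewrite cmodM cmodV cmodX cE -/x ler_pdivrMr ?exprn_gt0 ?expR_gt0//.
  apply: le_trans (LC z) _; rewrite -/x (max_idPr x0).
  rewrite expr2 mulrA ler_pM2r ?expR_gt0//.
  have -> : expR (x / 2) = expR (x / 4) * expR (x / 4) by rewrite -expRD; congr expR; field.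
  have zz : (1 + cmod z) ^+ N <= K ^+ N * ((1 + x) ^+ N * (1 + `|y|) ^+ N).
    have h1 := cmod_ge0 z; have h2 := normr_ge0 y.
    have h3 := mulr_ge0 (addr_ge0 ler01 x0) (addr_ge0 ler01 h2).
    rewrite -!exprMn lerXn2r ?nnegrE//; [lra|exact: mulr_ge0 (ltW K0) h3|].
      by have := zK z; rewrite -/x -/y (ger0_norm x0).
  apply: le_trans (ler_wpM2l C0 zz) _.
  have e1 : (1 + `|y|) ^+ N <= expR (x / 4).
    have : expR (kap y / 4) <= expR (x / 4) by rewrite ler_expR; lra.
    apply: le_trans; rewrite kapE ler_peMr ?exprn_ge0 ?addr_ge0//.
    by have := expR_ge1Dx (X0 / 4); lra.
  have e2 : C * K ^+ N * (1 + x) ^+ N <= cmod b / 2 * expR (x / 4).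
    have x1 : 0 < 1 + x by lra.
    rewrite -(ler_pM2r x1) -(mulrA _ _ (1 + x)) -exprSr.
    apply: le_trans (ler_wpM2l KN0 (hK1 x x0)) _.
    have h : C * K ^+ N * K1 <= cmod b / 2 * (1 + x).
      have : X0 <= 1 + x.
        apply: le_trans (_ : x <= _); rewrite ?lerDr// (le_trans _ zD)//.
        by rewrite lerDr mulr_ge0// ln_ge0// lerDl.
      by move=> /(ler_wpM2r (ltW b_gt0)); rewrite X0b; lra.
    have := ler_wpM2r (expR_ge0 (x / 4)) h; lra.
  have yN0 : 0 <= (1 + `|y|) ^+ N by rewrite exprn_ge0 ?addr_ge0.
  have e20 : 0 <= C * K ^+ N * (1 + x) ^+ N by rewrite mulr_ge0// exprn_ge0//; lra.
  have := ler_pM e20 yN0 e2 e1; lra.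
pose c0 := sqrtc b.
have c02 : c0 ^+ 2 = b by exact: sqr_sqrtc.
have c0n0 : c0 != 0 by apply: contraNneq b0 => c00; rewrite -c02 c00 expr0n.
(* The square of [f / (c E)] is within 1/2 of 1, whereas a purely imaginary number has a square at
   distance at least 1 from 1. *)
have Dsq c z : c ^+ 2 = b -> D z -> complex.Re (f z / E z / c) != 0.
  move=> cb /Dsmall h.
  have cn0 : c != 0 by apply: contraNneq b0 => c00; rewrite -cb c00 expr0n.
  have {}h : cmod ((f z / E z / c) ^+ 2 - 1) <= 1 / 2.
    have -> : (f z / E z / c) ^+ 2 - 1 = (f z ^+ 2 / E z ^+ 2 - b) / b.
      by rewrite -cb; field; rewrite E0 cn0.
    by rewrite cmodM cmodV ler_pdivrMr//; lra.
  move: h; case: (f z / E z / c) => x y h /=.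
  apply/eqP => x00; rewrite x00 in h.
  have := Re_le_cmod (- ((0 +i* y) ^+ 2 - 1)).
  rewrite cmodN expr2/= => h'; have := sqr_ge0 y; rewrite expr2; lra.
(* For [N > 0] the region [D] is not convex, [kap] being concave on each half-line. In the
   coordinates [(s, y)] it becomes the half-plane [0 <= s], where segments from the origin stay
   inside. *)
pose Z (s y : R) : R[i] := a^-1 * ((kap y + s) +i* y).
have aZ s y : a * Z s y = (kap y + s) +i* y by rewrite /Z mulVKf.
have DZ s y : 0 <= s -> D (Z s y) by move=> s0; rewrite /D aZ/= lerDl.
have ZD z : D z -> z = Z (complex.Re (a * z) - kap (complex.Im (a * z))) (complex.Im (a * z)).
  move=> _; apply: (mulfI a0); rewrite aZ [X in X +i* _]addrC subrK.
  by case: (a * z).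
have sign c z : c ^+ 2 = b -> 0 < complex.Re (f (Z 0 0) / E (Z 0 0) / c) ->
    D z -> 0 < complex.Re (f z / E z / c).
  move=> cb pos zD; rewrite (ZD z zD).
  have s0 : 0 <= complex.Re (a * z) - kap (complex.Im (a * z)) by rewrite subr_ge0.
  move: s0; set s := _ - _; set y := complex.Im _ => s0.
  pose gam t := Z (t * s) (t * y).
  have -> : Z s y = gam 1 by rewrite /gam !mul1r.
  apply: (@Re_sign_const (fun w => f w / E w / c) gam
    ((cmod a)^-1 * (4 * N%:R * `|y| + `|s| + `|y|))).
  - move=> w; apply: contM; last exact: cont_cst.
    by apply: contM; [exact: cdiff_cont|apply: contV => //; exact: cdiff_cont].
  - move=> t u; rewrite /gam /Z -mulrBr cmodM cmodV -[leRHS]mulrA ler_pM2l//.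
    apply: le_trans (cmod_le_ReIm _) _ => /=.
    have -> : kap (t * y) + t * s + - (kap (u * y) + u * s) =
      4 * N%:R * (ln (1 + `|t * y|) - ln (1 + `|u * y|)) + (t - u) * s.
      by rewrite /kap; ring.
    have -> : t * y + - (u * y) = (t - u) * y by ring.
    have h := ln1D_lipschitz (t * y) (u * y).
    have tuy : `|t * y - u * y| = `|t - u| * `|y| by rewrite -mulrBl normrM.
    rewrite tuy in h; move: h; set l := ln _ - ln _ => h.
    have N4 : 0 <= 4 * N%:R :> R by rewrite mulr_ge0.
    apply: le_trans (lerD (ler_normD _ _) (lexx _)) _.
    rewrite (normrM (4 * N%:R)) (normrM (t - u) s) (normrM (t - u) y) (ger0_norm N4).
    by have := ler_wpM2l N4 h; lra.
  - move=> t /andP[t0 t1]; apply: Dsq => //; apply: DZ; exact: mulr_ge0.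
  - by rewrite /gam !mul0r.
have [c cb cpos] : exists2 c, c ^+ 2 = b & 0 < complex.Re (f (Z 0 0) / E (Z 0 0) / c).
  have := Dsq c0 _ c02 (DZ 0 0 (lexx 0)).
  rewrite neq_lt => /orP[neg|pos]; last by exists c0.
  exists (- c0); rewrite ?sqrrN// invrN mulrN.
  by move: neg; case: (_ / c0) => x y /=; rewrite oppr_gt0.
exists c => //.
have cn0 : c != 0 by apply: contraNneq b0 => c00; rewrite -cb c00 expr0n.
have c_gt0 : 0 < cmod c by rewrite cmod_gt0.
pose d z := f z - c * E z.
have dd z : cdiff d z by apply: cdiffB => //; exact: cdiffM (cdiff_cst _ _) _.
have dD z : D z -> cmod (d z) <= C / cmod c * (1 + cmod z) ^+ N.
  move=> zD; have h := sign c z cb cpos zD.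
  have x0 : 0 <= complex.Re (a * z) by exact: le_trans (kap0 _) zD.
  have b1 : cmod (c * E z) <= cmod (f z + c * E z).
    have -> : f z + c * E z = (f z / E z / c + 1) * (c * E z).
      by field; rewrite E0 cn0.
    rewrite [leRHS]cmodM ler_peMl ?cmod_ge0//; apply: le_trans (Re_le_cmod _).
    by move: h; case: (_ / c) => x y /=; lra.
  have b2 : cmod (d z) * cmod (f z + c * E z) <= C * (1 + cmod z) ^+ N * cmod (E z).
    rewrite -cmodM (_ : d z * _ = f z ^+ 2 - b * cexp (a * z)).
      by apply: le_trans (LC z) _; rewrite cE (max_idPr x0).
    by rewrite /d sqE -cb; ring.
  have E_gt0 : 0 < cmod (E z) by rewrite cmod_gt0.
  have := ler_wpM2l (cmod_ge0 (d z)) b1; rewrite cmodM mulrA => b3.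
  have := le_trans b3 b2; rewrite ler_pM2r// => b4.
  by rewrite mulrAC ler_pdivlMr.
(* [expR (kap y / 2)] is a multiple of [(1 + |y|) ^ (2 N)]; with the degree [N] of [fC] this makes
   [3 N]. *)
have dnD z : ~~ D z -> cmod (d z) <=
    (C + cmod c) * expR (X0 / 2) * (1 + cmod a) ^+ (2 * N) * (1 + cmod z) ^+ (3 * N).
  rewrite /D -ltNge => zD; set x := complex.Re _ in zD; set y := complex.Im _ in zD.
  have mx : Num.max 0 x <= kap y by rewrite ge_max kap0 ltW.
  have z1 : 1 <= 1 + cmod z by rewrite lerDl cmod_ge0.
  have e1 : expR (Num.max 0 x / 2) <=
      expR (X0 / 2) * ((1 + cmod a) ^+ (2 * N) * (1 + cmod z) ^+ (2 * N)).
    apply: le_trans (_ : expR (kap y / 2) <= _); first by rewrite ler_expR; lra.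
    have -> : expR (kap y / 2) = (1 + `|y|) ^+ (2 * N) * expR (X0 / 2).
      have -> : kap y / 2 = kap y / 4 + kap y / 4 by field.
      rewrite expRD kapE mul2n -addnn exprD.
      by rewrite (_ : X0 / 2 = X0 / 4 + X0 / 4) ?expRD; [ring|field].
    rewrite mulrC ler_pM2l ?expR_gt0// -exprMn.
    have y0 := normr_ge0 y; have ca := cmod_ge0 a; have cz := cmod_ge0 z.
    have yaz : `|y| <= cmod a * cmod z.
      rewrite -cmodM /y; case: (a * z) => u v /=.
      by rewrite cmod_sqrt/= -sqrtr_sqr ler_wsqrtr// lerDr sqr_ge0.
    have caz := mulr_ge0 ca cz.
    by rewrite lerXn2r ?nnegrE//; lra.
  apply: le_trans (cmodB _ _) _; rewrite cmodM.
  have e2 : cmod (E z) <= expR (Num.max 0 x / 2).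
    by rewrite cE ler_expR ler_wpM2r// le_max lexx orbT.
  have zN : 1 <= (1 + cmod z) ^+ N by rewrite exprn_ege1.
  have e3 : cmod (f z) + cmod c * cmod (E z) <=
      (C + cmod c) * (1 + cmod z) ^+ N * expR (Num.max 0 x / 2).
    rewrite mulrDl mulrDl; apply: lerD; first exact: fC.
    rewrite -mulrA ler_pM2l//; apply: le_trans e2 _.
    by rewrite ler_peMl ?expR_ge0.
  apply: le_trans e3 _.
  have k0 : 0 <= (C + cmod c) * (1 + cmod z) ^+ N.
    by rewrite mulr_ge0 ?addr_ge0 ?cmod_ge0//; lra.
  apply: le_trans (ler_wpM2l k0 e1) _.
  have -> : (3 * N = N + 2 * N)%N by rewrite mulSn.
  by rewrite exprD; lra.
pose C1 := C / cmod c; pose C2 := (C + cmod c) * expR (X0 / 2) * (1 + cmod a) ^+ (2 * N).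
have C10 : 0 <= C1 by rewrite divr_ge0 // ltW.
have C20 : 0 <= C2.
  by rewrite !mulr_ge0 ?expR_ge0 ?exprn_ge0 ?addr_ge0 ?cmod_ge0.
have dC z : cmod (d z) <= (C1 + C2) * (1 + cmod z) ^+ (3 * N).
  have z1 : 1 <= 1 + cmod z by rewrite lerDl cmod_ge0.
  have [zD|zD] := boolP (D z).
    have zN0 : 0 <= (1 + cmod z) ^+ N by rewrite exprn_ge0// (le_trans ler01).
    apply: le_trans (dD z zD) _; apply: ler_pM => //; first by rewrite -/C1 lerDl.
    by rewrite ler_weXn2l// leq_pmull.
  apply: le_trans (dnD z zD) _; rewrite ler_wpM2r ?exprn_ge0//; first lra.
  by rewrite -/C2 lerDr.
have [p pE] : exists p : {poly R[i]}, forall w, w \notin [::] -> d w = p.[w].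
  apply: (@liouville_poly _ [::] d (3 * N) ((C1 + C2) * 2 ^+ (3 * N)) 1) => //.
    by move=> w; exact: cdiff_cont.
  move=> w w1; apply: le_trans (dC w) _.
  have w2 : 1 + cmod w <= 2 * cmod w by lra.
  rewrite -mulrA ler_wpM2l ?addr_ge0// -exprMn.
  by apply: lerXn2r; rewrite ?nnegrE ?mulr_ge0 ?addr_ge0 ?cmod_ge0.
by exists p => z; rewrite -pE// /d addrC subrK.
Qed.

End Asymptotics.

(** * Improving the growth bound by iterating the equation *)

Section Bootstrap.
Context (R : realType).
Implicit Types (f : R[i] -> R[i]) (z w : R[i]).

(** All larger exponents are allowed so that the four coefficients of [Lop] can share one. *)
Lemma poly_growth (p : {poly R[i]}) : exists2 C : R, 0 <= C &
  exists N, forall M z, (N <= M)%N -> cmod p.[z] <= C * (1 + cmod z) ^+ M.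
Proof.
elim/poly_ind: p => [|p c [C C0 [N pC]]].
  by exists 0 => //; exists 0%N => M z _; rewrite horner0 cmod0 mul0r.
exists (C + cmod c); first by rewrite addr_ge0 ?cmod_ge0.
exists N.+1 => -[//|M] z NM; rewrite hornerMXaddC; apply: le_trans (cmodD _ _) _.
have z1 : 1 <= 1 + cmod z by rewrite lerDl cmod_ge0.
rewrite mulrDl; apply: lerD; last by rewrite ler_peMr ?cmod_ge0// exprn_ege1.
rewrite cmodM exprSr mulrA; apply: ler_pM; rewrite ?cmod_ge0 ?pC//.
by rewrite lerDr.
Qed.

(** The radius [1 + |eta|] reaches the shifted point as well as the unit circle used in Cauchy's
    estimate for [f']. *)
Lemma Lop_bound (g h u v : {poly R[i]}) (eta : R[i]) f : entire f ->
  exists2 A : R, 0 <= A & exists N, forall z M, 0 <= M ->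
    (forall w, cmod (w - z) <= 1 + cmod eta -> cmod (f w) <= M) ->
    cmod (Lop g h u v eta f z) <= A * (1 + cmod z) ^+ N * (M + 1).
Proof.
move=> ef.
have [Cg Cg0 [Ng hg]] := poly_growth g; have [Ch Ch0 [Nh hh]] := poly_growth h.
have [Cu Cu0 [Nu hu]] := poly_growth u; have [Cv Cv0 [Nv hv]] := poly_growth v.
exists (Cg + Ch *+ 2 + Cu + Cv); first lra.
exists (Ng + Nh + Nu + Nv)%N => z M M0 fM.
set N := (_ + _)%N.
have {}hg : cmod g.[z] <= Cg * (1 + cmod z) ^+ N.
  by apply: hg; rewrite /N -!addnA leq_addr.
have {}hh : cmod h.[z] <= Ch * (1 + cmod z) ^+ N.
  by apply: hh; rewrite /N -!addnA addnCA leq_addr.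
have {}hu : cmod u.[z] <= Cu * (1 + cmod z) ^+ N.
  by apply: hu; rewrite /N addnAC leq_addl.
have {}hv : cmod v.[z] <= Cv * (1 + cmod z) ^+ N.
  by apply: hv; rewrite /N leq_addl.
have eta0 := cmod_ge0 eta.
have f1 : cmod (f (z + eta)) <= M by apply: fM; rewrite addrC addKr; lra.
have f2 : cmod (f z) <= M by apply: fM; rewrite subrr cmod0; lra.
have f3 : cmod (derive1 f z) <= M *+ 2.
  rewrite -[leRHS]divr1; apply: cauchy_estimate => // w wz.
  by apply: fM; rewrite wz; lra.
have z1 : 0 <= (1 + cmod z) ^+ N by rewrite exprn_ge0// addr_ge0 ?cmod_ge0.
rewrite /Lop; apply: le_trans (cmodD _ _) _.
apply: le_trans (lerD (cmodD _ _) (lexx _)) _.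
apply: le_trans (lerD (lerD (cmodD _ _) (lexx _)) (lexx _)) _.
rewrite !cmodM.
have k1 := ler_pM (cmod_ge0 _) (cmod_ge0 _) hg f1.
have k2 := ler_pM (cmod_ge0 _) (cmod_ge0 _) hh f3.
have k3 := ler_pM (cmod_ge0 _) (cmod_ge0 _) hu f2.
have l1 := mulr_ge0 Cg0 z1; have l2 := mulr_ge0 Ch0 z1.
have l3 := mulr_ge0 Cu0 z1; have l4 := mulr_ge0 (mulr_ge0 Cv0 z1) M0.
lra.
Qed.

(** Powers of [j] lose against [2 ^ j]. Here [c] will be [1 + |z|], so [j] depends on [z]. *)
Lemma exists_expr_le_pow2 (K c d : R) k : 0 <= K -> 0 <= c -> 0 <= d ->
  exists j, K * (c + j%:R * d) ^+ k <= 2 ^+ j.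
Proof.
move=> K0 c0 d0; have [K1 K10 hK1] := expr_le_expR R k.
pose B := K * (c + d) ^+ k * K1.
have B0 : 0 <= B by rewrite mulr_ge0 ?(ltW K10)// mulr_ge0// exprn_ge0// addr_ge0.
exists (Num.Def.archi_bound B); set j := Num.Def.archi_bound B.
have Bj : B <= 1 + j%:R by have := archi_boundP B0; rewrite -/j; lra.
have j0 : 0 <= j%:R :> R by [].
have j1 : 0 < 1 + j%:R :> R by lra.
have e4 : expR (j%:R / 4) <= 2 ^+ j :> R.
  rewrite expRM_natl lerXn2r ?nnegrE ?expR_ge0//.
  have := expR_ge1Dx (- (4^-1) : R); rewrite expRN => h.
  have e0 := expR_gt0 (4^-1 : R).
  have := ler_wpM2r (ltW e0) h; rewrite mulVf ?gt_eqF//; lra.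
apply: le_trans e4; rewrite -(ler_pM2r j1).
have h1 : (c + j%:R * d) ^+ k <= (c + d) ^+ k * (1 + j%:R) ^+ k.
  have cj := mulr_ge0 c0 j0; have jd := mulr_ge0 j0 d0.
  rewrite -exprMn; apply: lerXn2r; rewrite ?nnegrE; [lra| |lra].
  by rewrite mulr_ge0//; lra.
have h2 : K * (c + j%:R * d) ^+ k * (1 + j%:R) <= K * (c + d) ^+ k * (1 + j%:R) ^+ k.+1.
  rewrite exprSr !mulrA ler_wpM2r ?(ltW j1)// -mulrA ler_wpM2l//.
apply: le_trans h2 _.
have Kcd : 0 <= K * (c + d) ^+ k by rewrite mulr_ge0// exprn_ge0// addr_ge0.
apply: le_trans (ler_wpM2l Kcd (hK1 _ j0)) _; rewrite mulrA -/B mulrC.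
by rewrite ler_wpM2l ?expR_ge0.
Qed.

(** The bound [C5 (1 + |z|) ^ N W X_j] reproduces itself with the same [C5] and [N] while [X_j] is
    replaced by a square root of its value on a larger disc. Because these constants do not depend
    on [j], a different [j] may be chosen for each [z], and [X_j] is then at most [expR 1]. *)
Lemma bootstrap (g h u v : {poly R[i]}) (a b eta : R[i]) f (K : R) k :
  entire f ->
  (forall z, f z ^+ 2 + Lop g h u v eta f z = b * cexp (a * z)) ->
  0 <= K -> (forall z, cmod (f z) <= expR (K * (1 + cmod z) ^+ k)) ->
  exists C N, forall z,
    let B := C * (1 + cmod z) ^+ N * expR (Num.max 0 (complex.Re (a * z)) / 2) in
    cmod (f z) <= B /\ cmod (f z ^+ 2 - b * cexp (a * z)) <= B.
Proof.
move=> ef feq K0 fK.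
have [A A0 [N LA]] := Lop_bound g h u v eta ef.
(* This is [max (1, |E z|)], and [Gam] below bounds its variation over a disc of radius [del]. *)
pose W z := expR (Num.max 0 (complex.Re (a * z)) / 2).
pose del := 1 + cmod eta.
have del0 : 0 <= del by rewrite addr_ge0 ?cmod_ge0.
have W1 z : 1 <= W z.
  have := expR_ge1Dx (Num.max 0 (complex.Re (a * z)) / 2).
  have : 0 <= Num.max 0 (complex.Re (a * z)) by rewrite le_max lexx.
  by rewrite /W; lra.
pose Gam := expR (cmod a * del / 2).
have Gam1 : 1 <= Gam.
  have := expR_ge1Dx (cmod a * del / 2); have := mulr_ge0 (cmod_ge0 a) del0.
  by rewrite /Gam; lra.
have WG z w : cmod (w - z) <= del -> W w <= Gam * W z.
  move=> wz; rewrite /W /Gam -expRD ler_expR -mulrDl ler_pM2r ?invr_gt0//.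
  have aw : complex.Re (a * w) <= cmod a * del + complex.Re (a * z).
    have := Re_le_cmod (a * (w - z)); rewrite cmodM mulrBr.
    have := ler_wpM2l (cmod_ge0 a) wz.
    by case: (a * w) (a * z) => ? ? [? ?] /=; lra.
  have := mulr_ge0 (cmod_ge0 a) del0.
  by rewrite ge_max; case: (leP 0 (complex.Re (a * z))) => h2 h1; apply/andP; split; lra.
have feq' z : cmod (f z ^+ 2 - b * cexp (a * z)) = cmod (Lop g h u v eta f z).
  by rewrite -feq opprD addrA subrr sub0r cmodN.
have expW z : cmod (cexp (a * z)) <= W z ^+ 2.
  rewrite cmod_cexp /W -expRM_natl ler_expR.
  by have : complex.Re (a * z) <= Num.max 0 (complex.Re (a * z)) by [rewrite le_max lexx orbT]; lra.
have dN : 1 <= (1 + del) ^+ N by rewrite exprn_ege1// lerDl.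
pose B := 2 * A * Gam * (1 + del) ^+ N.
have B0 : 0 <= B by rewrite /B !mulr_ge0//; lra.
(* Chosen so that [|b| + B C5 <= C5 ^ 2], which closes the induction without enlarging the
   constant. *)
pose C5 := cmod b + B + 1.
have b0 := cmod_ge0 b.
have C51 : 1 <= C5 by rewrite /C5; lra.
have C50 := le_trans ler01 C51.
(* The remaining exponential after [j] uses: [j] halvings against [j] enlargements of the radius by
   [del]. *)
pose X j (r : R) := expR (K * (1 + r + j%:R * del) ^+ k / 2 ^+ j).
have X1 j r : 0 <= r -> 1 <= X j r.
  move=> r0.
  have j0 : 0 <= j%:R * del by rewrite mulr_ge0.
  have : 0 <= K * (1 + r + j%:R * del) ^+ k / 2 ^+ j.
    by rewrite divr_ge0 ?exprn_ge0// mulr_ge0// exprn_ge0//; lra.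
  by have := expR_ge1Dx (K * (1 + r + j%:R * del) ^+ k / 2 ^+ j); rewrite -/(X j r); lra.
have XS j r : X j (r + del) = X j.+1 r ^+ 2.
  rewrite /X -expRM_natl; congr expR.
  have -> : 1 + (r + del) + j%:R * del = 1 + r + j.+1%:R * del by rewrite -natr1; ring.
  by rewrite exprS; field; rewrite expf_neq0.
have nz z : 1 <= (1 + cmod z) ^+ N by rewrite exprn_ege1// lerDl cmod_ge0.
have nz0 z := le_trans ler01 (nz z); have W0 z := le_trans ler01 (W1 z).
have shift z w : cmod (w - z) <= del -> (1 + cmod w) ^+ N <= (1 + del) ^+ N * (1 + cmod z) ^+ N.
  move=> wz; have := cmodD (w - z) z; rewrite subrK => h1.
  have z0 := cmod_ge0 z; have w0 := cmod_ge0 w; have zd := mulr_ge0 z0 del0.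
  by rewrite -exprMn lerXn2r ?nnegrE//; lra.
have iter j z : cmod (f z) <= C5 * (1 + cmod z) ^+ N * W z * X j (cmod z).
  elim: j z => [|j IH] z.
    apply: le_trans (fK z) _; rewrite /X mul0r addr0 expr0 divr1.
    by rewrite ler_peMl ?expR_ge0// !mulr_ege1.
  pose M := C5 * ((1 + del) ^+ N * (1 + cmod z) ^+ N) * (Gam * W z) * X j (cmod z + del).
  have XM1 : 1 <= X j (cmod z + del) by apply: X1; rewrite addr_ge0 ?cmod_ge0.
  have M1 : 1 <= M by rewrite /M !mulr_ege1.
  have fM w : cmod (w - z) <= del -> cmod (f w) <= M.
    move=> wz; apply: le_trans (IH w) _; rewrite /M.
    have Xw : X j (cmod w) <= X j (cmod z + del).
      rewrite /X ler_expR ler_pM2r ?invr_gt0 ?exprn_gt0// ler_wpM2l//.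
      have j0 : 0 <= j%:R * del by rewrite mulr_ge0.
      have := cmodD (w - z) z; rewrite subrK => h1.
      have z0 := cmod_ge0 z; have w0 := cmod_ge0 w.
      by rewrite lerXn2r ?nnegrE//; lra.
    have w1 := W1 w; have z2 := nz w; have x1 := X1 j _ (cmod_ge0 w).
    apply: ler_pM => //; [|lra|].
      by rewrite !mulr_ge0//; lra.
    apply: ler_pM; [by rewrite mulr_ge0//; lra|lra| |exact: WG].
    by rewrite ler_wpM2l ?shift//; lra.
  have := LA z M (le_trans ler01 M1) fM; rewrite -feq' => hL.
  have fsq : cmod (f z) ^+ 2 <= (C5 * (1 + cmod z) ^+ N * W z * X j.+1 (cmod z)) ^+ 2.
    rewrite -cmodX -[f z ^+ 2](subrK (b * cexp (a * z))).
    apply: le_trans (cmodD _ _) _; rewrite cmodM.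
    have h1 := ler_wpM2l b0 (expW z).
    rewrite [leRHS]exprMn -XS.
    move: hL M1; rewrite /M; set x := X j _ in XM1 *; move: (nz z) (W1 z) h1.
    move: (W z) ((1 + cmod z) ^+ N) => w n n1 w1 h1 hL M1.
    apply: le_trans (lerD hL h1) _.
    have n0 := le_trans ler01 n1; have w0 := le_trans ler01 w1.
    have x0 := le_trans ler01 XM1.
    have AN : 0 <= A * n by rewrite mulr_ge0.
    have s1 := ler_wpM2l AN M1.
    have wx : 1 <= w ^+ 2 * x by rewrite mulr_ege1// exprn_ege1.
    have nn : 1 <= n ^+ 2 by rewrite exprn_ege1.
    have s2 : cmod b * w ^+ 2 <= cmod b * (n ^+ 2 * w ^+ 2 * x).
      rewrite ler_wpM2l//.
      have w20 : 0 <= w ^+ 2 by rewrite sqr_ge0.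
      have := ler_wpM2r w20 (mulr_ege1 nn XM1); lra.
    have s3 : B * C5 * (n ^+ 2 * w * x) <= B * C5 * (n ^+ 2 * w ^+ 2 * x).
      have BC : 0 <= B * C5 by rewrite mulr_ge0.
      rewrite ler_wpM2l//.
      have nx : 0 <= n ^+ 2 * x * w by rewrite !mulr_ge0 ?sqr_ge0.
      have := ler_wpM2l nx w1; lra.
    have s4 : (cmod b + B * C5) * (n ^+ 2 * w ^+ 2 * x) <= C5 ^+ 2 * (n ^+ 2 * w ^+ 2 * x).
      rewrite ler_wpM2r//; first by rewrite !mulr_ge0 ?sqr_ge0.
      have := mulr_ge0 b0 B0; have := mulr_ge0 b0 b0.
      by rewrite /C5; lra.
    have -> : (C5 * n * w) ^+ 2 * x = C5 ^+ 2 * (n ^+ 2 * w ^+ 2 * x) by ring.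
    apply: le_trans s4; clear - s1 s2 s3; clearbody C5; move: s3; rewrite /B => s3.
    lra.
  have nnX : 0 <= C5 * (1 + cmod z) ^+ N * W z * X j.+1 (cmod z).
    have x0 := le_trans ler01 (X1 j.+1 _ (cmod_ge0 z)).
    by rewrite !mulr_ge0.
  by move: fsq; rewrite ler_pXn2r// ?nnegrE ?cmod_ge0.
pose C6 := C5 * expR 1.
have e1 : 1 <= expR 1 :> R by have := expR_ge1Dx (1 : R); lra.
have C61 : 1 <= C6 by rewrite mulr_ege1.
have fC z : cmod (f z) <= C6 * (1 + cmod z) ^+ N * W z.
  have z0 : 0 <= 1 + cmod z by rewrite addr_ge0 ?cmod_ge0.
  have [j hj] := exists_expr_le_pow2 k K0 z0 del0.
  apply: le_trans (iter j z) _.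
  have -> : C6 * (1 + cmod z) ^+ N * W z = C5 * (1 + cmod z) ^+ N * W z * expR 1.
    by rewrite /C6; ring.
  rewrite ler_wpM2l//.
    by rewrite !mulr_ge0.
  by rewrite /X ler_expR ler_pdivrMr ?exprn_gt0// mul1r.
pose C7 := C6 * (1 + del) ^+ N * Gam.
have C71 : 1 <= C7 by rewrite !mulr_ege1.
exists (C6 + 2 * A * C7), (N + N)%N => z B'.
have w1 := W1 z; have n1 := nz z.
have b2 : cmod (f z ^+ 2 - b * cexp (a * z)) <= 2 * A * C7 * (1 + cmod z) ^+ (N + N) * W z.
  rewrite feq'.
  pose M := C7 * (1 + cmod z) ^+ N * W z.
  have M1 : 1 <= M by rewrite /M !mulr_ege1.
  have := LA z M (le_trans ler01 M1).
  have fM w : cmod (w - z) <= 1 + cmod eta -> cmod (f w) <= M.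
    move=> wz; apply: le_trans (fC w) _.
    have -> : M = C6 * ((1 + del) ^+ N * (1 + cmod z) ^+ N) * (Gam * W z).
      by rewrite /M /C7; ring.
    apply: ler_pM; [|by have := W1 w; lra| |exact: WG].
      by rewrite mulr_ge0// (le_trans ler01).
    by rewrite ler_wpM2l ?shift//; lra.
  move=> /(_ fM) hL; apply: le_trans hL _.
  have AN : 0 <= A * (1 + cmod z) ^+ N by rewrite mulr_ge0.
  have := ler_wpM2l AN M1; rewrite /M exprD; lra.
have Bge : 0 <= A * C7 by rewrite mulr_ge0// (le_trans ler01).
have b1 : cmod (f z) <= C6 * (1 + cmod z) ^+ (N + N) * W z.
  apply: le_trans (fC z) _; rewrite ler_wpM2r; [by []|lra|].
  by rewrite ler_wpM2l; [by []|lra|rewrite exprD ler_peMr//; lra].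
have nn1 : 1 <= (1 + cmod z) ^+ (N + N) * W z by rewrite exprD !mulr_ege1.
have nn0 := le_trans ler01 nn1; have C60 := le_trans ler01 C61.
have q1 := mulr_ge0 Bge nn0; have q2 := mulr_ge0 C60 nn0.
by rewrite /B' -/(W z); split; lra.
Qed.

End Bootstrap.

(** * Riemann sums over a circle, and the boundary action of a Moebius map *)

Section CircleMeans.
Context (R : realType).
Implicit Types (f : R[i] -> R[i]) (z w : R[i]).
Let mu := @lebesgue_measure R.

Lemma heine (y : R -> R) (a b : R) : continuous y -> forall e : R, 0 < e ->
  exists2 d : R, 0 < d & forall s t, a <= s <= b -> `|s - t| < d -> `|y s - y t| < e.
Proof.
move=> cy e e0.
have := @segment_compact R a b => /compact_near_coveringP.
move=> /(_ R (0 : R)^'+ (fun d s => forall t, `|s - t| < d -> `|y s - y t| < e)) [].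
  move=> x _.
  have /cvgrPdist_lt/(_ _ (divr_gt0 e0 (ltr0n _ 2)))/nbhs_normP[d /= d0 hd] := cy x.
  have d20 : 0 < d / 2 by rewrite divr_gt0.
  exists (ball_ Num.norm x (d / 2), [set c : R | c < d / 2]) => /=.
    split; first by apply/nbhs_normP; exists (d / 2).
    exact: nbhs_right_lt.
  move=> [s c] [/= sx cd] t st.
  have h1 : `|y x - y s| < e / 2 by apply: hd; rewrite /ball_/=; lra.
  have h2 : `|y x - y t| < e / 2.
    apply: hd; rewrite /ball_/=.
    by have := ler_distD s x t; move: sx cd st; rewrite /ball_/=; lra.
  by have := ler_distD (y x) (y s) (y t); rewrite (distrC (y s) (y x)); lra.
move=> d /= d0 hd; exists (d / 2); first by rewrite divr_gt0.
move=> s t sab st.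
have dd : ball_ Num.norm 0 d (d / 2).
  by rewrite /ball_/= sub0r normrN gtr0_norm ?divr_gt0//; lra.
have d2 : 0 < d / 2 by rewrite divr_gt0.
by apply: (hd _ dd d2 s) => //=; rewrite in_itv.
Qed.

Lemma periodic_primitive (v : R -> R) : continuous v ->
  (forall x : R, v (x + pi *+ 2) = v x) ->
  exists2 V : R -> R, forall x : R, 0 <= x -> is_derive x 1 V (v x) &
    forall x : R, 0 <= x -> V (x + pi *+ 2) - V x = \int[mu]_(t in `[0, pi *+ 2]) v t.
Proof.
move=> cv vper.
have pi0 := @pi_gt0 R.
have iv a b : mu.-integrable `[a, b] (EFin \o v).
  apply: continuous_compact_integrable; first exact: segment_compact.
  exact: continuous_subspaceT.
(* Starting at -1 gives [V] a two-sided derivative at 0 as well. *)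
pose V (x : R) := \int[mu]_(t in `[-1, x]) v t.
have dV (x : R) : -1 < x -> is_derive x 1 V (v x).
  move=> x1; have xx : x < x + 1 by rewrite ltrDl.
  have [D E] := continuous_FTC1_closed xx (iv (-1) (x + 1)) x1 (cv x).
  have E' : 'D_1 V x = v x by rewrite -derive1E.
  exact: (DeriveDef D E').
exists V => [x x0|x x0]; first by apply: dV; lra.
pose D (t : R) := V (t + pi *+ 2) - V t.
have dD (t : R) : -1 < t -> is_derive t 1 D 0.
  move=> t1.
  have h1 : is_derive (t + pi *+ 2) 1 V (v (t + pi *+ 2)) by apply: dV; lra.
  have h2 : is_derive t 1 (fun s : R => s + pi *+ 2) 1.
    by apply: is_derive_eq; rewrite addr0.
  have h3 := @is_derive1_comp _ V (fun s : R => s + pi *+ 2) _ _ _ h1 h2.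
  have h4 := is_deriveB h3 (dV t t1).
  by apply: (is_derive_eq h4); rewrite mulr1 vper subrr.
have D0 : D x = D 0.
  have [||c _] := @MVT_segment R D (fun=> 0) 0 x x0.
  - by move=> t; rewrite in_itv/= => /andP[t0 _]; apply: dD; lra.
  - apply: derivable_within_continuous => t; rewrite in_itv/= => /andP[t0 _].
    by have [] := dD t (lt_le_trans (ltrN10 _) t0).
  by rewrite mul0r => /eqP; rewrite subr_eq0 => /eqP.
rewrite -/(D x) D0 /D add0r /V Rintegral_itvB.
- rewrite Rintegral_itv_obnd_cbnd//.
  by apply: integrableS (iv 0 (pi *+ 2)) => //; exact: subset_itv_oc_cc.
- exact: iv.
- by rewrite bnd_simp; lra.
- by rewrite bnd_simp; lra.
Qed.

(** The number of nodes must not depend on the starting point [sg]: a single product of [n] rotates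
    has to be bounded on the whole circle. *)
Lemma riemann_sum_le (y W dW : R -> R) : continuous y ->
  (forall s : R, 0 <= s -> is_derive s 1 W (dW s)) -> (forall s : R, 0 <= s -> y s <= dW s) ->
  forall e : R, 0 < e -> exists2 n : nat, (0 < n)%N & forall sg : R, 0 <= sg <= pi *+ 2 ->
    (pi *+ 2) / n%:R * (\sum_(j < n) y (sg + j%:R * (pi *+ 2 / n%:R))) <=
      W (sg + pi *+ 2) - W sg + pi *+ 2 * e.
Proof.
move=> cy dWW yW e e0.
have pi0 := @pi_gt0 R.
have p20 : 0 < pi *+ 2 :> R by rewrite mulrn_wgt0.
(* The nodes start below [pi *+ 2] and run through one further period. *)
have [d d0 hd] := heine 0 (pi *+ 4) cy e0.
pose n := (Num.Def.archi_bound (pi *+ 2 / d)).+1.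
have n0 : 0 < n%:R :> R by rewrite ltr0n.
pose h : R := pi *+ 2 / n%:R.
have h0 : 0 < h by rewrite divr_gt0.
have hdl : h < d.
  rewrite /h ltr_pdivrMr// mulrC -ltr_pdivrMr//.
  have := archi_boundP (divr_ge0 (ltW p20) (ltW d0)) => /lt_le_trans; apply.
  by rewrite ler_nat /n.
exists n => // sg /andP[sg0 sg2].
pose s j := sg + j%:R * h.
have nh : n%:R * h = pi *+ 2 by rewrite /h mulrC divfK// gt_eqF.
have step (j : 'I_n) : h * y (s j) <= W (s j.+1) - W (s j) + h * e.
  have s0 : 0 <= s j by rewrite addr_ge0// mulr_ge0// ltW.
  have sS : s j.+1 = s j + h by rewrite /s -natr1; ring.
  have sle : s j <= s j.+1 by rewrite sS; lra.
  have s4 : s j.+1 <= pi *+ 4.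
    have : j.+1%:R * h <= n%:R * h by rewrite ler_pM2r// ler_nat.
    by rewrite nh /s; lra.
  have [||c] := @MVT_segment R W dW (s j) (s j.+1) sle.
  - by move=> x; rewrite in_itv/= => /andP[x0 _]; apply: dWW; lra.
  - apply: derivable_within_continuous => x; rewrite in_itv/= => /andP[x0 _].
    by have [] := dWW x (le_trans s0 x0).
  rewrite in_itv/= sS => /andP[c1 c2] ->; rewrite addrAC subrr add0r.
  have c0 : 0 <= c by lra.
  have yc := yW c c0.
  have : `|y (s j) - y c| < e.
    apply: hd; first by apply/andP; split; lra.
    by rewrite distrC ger0_norm; lra.
  move=> /ltW; rewrite ler_norml => /andP[_ ye].
  have := ler_wpM2l (ltW h0) yc; have := ler_wpM2l (ltW h0) ye.
  lra.
rewrite -/h mulr_sumr.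
apply: le_trans (ler_sum _ (fun j _ => step j)) _.
rewrite big_split/= sumr_const card_ord -[_ *+ n]mulr_natl mulrA nh.
have -> : \sum_(i < n) (W (s i.+1) - W (s i)) = W (s n) - W (s 0%N).
  by rewrite -(big_mkord xpredT (fun i => W (s i.+1) - W (s i))) telescope_sumr.
by rewrite /s nh mul0r addr0.
Qed.

(* [(2 e^(is) + 1) / (2 + e^(is)) = e^(i angle s)] *)
Definition angle (s : R) : R := s - atan (sin s / (2 + cos s)) *+ 2.

Lemma cos2_gt0 (s : R) : 0 < 2 + cos s.
Proof. by have := @cos_geN1 R s; lra. Qed.

(** This derivative is the Poisson kernel [(1 - r ^ 2) / (1 + 2 r cos s + r ^ 2)] at [r = 1/2]. It
    is at least 1/3, the origin of the factor 3 in [poisson_bound]. *)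
Lemma is_derive_angle (s : R) : is_derive s 1 angle (3 / (5 + 4 * cos s)).
Proof.
have c0 := cos2_gt0 s.
have n0 : 2 + cos s != 0 by rewrite gt_eqF.
have sc := @cos2Dsin2 R s.
have d2 : is_derive s 1 (fun x : R => 2 + cos x) (- sin s).
  rewrite -[- sin s]add0r.
  exact: (is_deriveD (is_derive_cst (2 : R) s 1) (is_derive_cos s)).
have d3 := @is_deriveV _ (fun x : R => 2 + cos x) s (- sin s) 1 n0 d2.
have d4 := is_deriveM (is_derive_sin s) d3.
have d5 : is_derive (sin s / (2 + cos s)) 1 atan (1 + (sin s / (2 + cos s)) ^+ 2)^-1.
  by apply: DeriveDef; [exact: derivable_atan|rewrite -derive1E derive1_atan].
have d6 := @is_derive1_comp _ atan (fun x => sin x * (2 + cos x)^-1) _ _ _ d5 d4.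
have d7 := is_deriveB (is_derive_id s 1) (is_deriveD d6 d6).
apply: (is_derive_eq d7).
rewrite /GRing.scale/= mulr2n.
have q1 : 5 + 4 * cos s != 0 by rewrite gt_eqF//; have := @cos_geN1 R s; lra.
have -> : (1 + (sin s / (2 + cos s)) ^+ 2)^-1 = (2 + cos s) ^+ 2 / (5 + 4 * cos s).
  have -> : 1 + (sin s / (2 + cos s)) ^+ 2 = (5 + 4 * cos s) / (2 + cos s) ^+ 2.
    have -> : (sin s / (2 + cos s)) ^+ 2 = sin s ^+ 2 / (2 + cos s) ^+ 2.
      by rewrite expr_div_n.
    have -> : sin s ^+ 2 = 1 - cos s ^+ 2 by rewrite -sc addrAC subrr add0r.
    by field.
  by rewrite invf_div.
have -> : sin s * (- (2 + cos s) ^- 2 * - sin s) = sin s ^+ 2 / (2 + cos s) ^+ 2 by field.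
have -> : sin s ^+ 2 = 1 - cos s ^+ 2 by rewrite -sc addrAC subrr add0r.
by field; rewrite q1 n0.
Qed.

Lemma angle_period s : angle (s + pi *+ 2) = angle s + pi *+ 2.
Proof. by rewrite /angle sinD2pi cosD2pi; ring. Qed.

Lemma cexp_imD (s t : R) : cexp (0 +i* (s + t)) = cexp (0 +i* s) * cexp (0 +i* t).
Proof.
by rewrite -cexpD; congr cexp; apply/eqP; rewrite eq_complex/= addr0 !eqxx.
Qed.

(** The numerator is [e^(is)] times the conjugate of the denominator, and the denominator has
    argument [atan (sin s / (2 + cos s))]; this argument is thus subtracted twice from [s]. *)
Lemma cexp_angle (s : R) :
  (2%:R * cexp (0 +i* s) + 1) / (2%:R + cexp (0 +i* s)) = cexp (0 +i* angle s).
Proof.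
have c0 := cos2_gt0 s.
have n0 : 2 + cos s != 0 by rewrite gt_eqF.
set t := sin s / (2 + cos s).
have r0 : 0 < 1 + t ^+ 2 by rewrite ltr_wpDr// sqr_ge0.
have sq0 : Num.sqrt (1 + t ^+ 2) != 0 by rewrite sqrtr_eq0 -ltNge.
have ca : cos (atan t) = (Num.sqrt (1 + t ^+ 2))^-1 by exact: cos_atan.
have cosn0 : cos (atan t) != 0 by rewrite ca invr_eq0.
have sa : sin (atan t) = t * cos (atan t).
  by rewrite -{2}[t]atanK /tan divfK.
have ca2 : cos (atan t) ^+ 2 = (1 + t ^+ 2)^-1 by rewrite ca exprVn sqr_sqrtr// ltW.
pose k : R[i] := 1 +i* t.
have E1 : cexp (0 +i* atan t) = (cos (atan t))%:C * k.
  rewrite /cexp/= expR0 mul1r sa; apply/eqP; rewrite eq_complex/=.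
  by apply/andP; split; apply/eqP; ring.
have k0 : k != 0 by rewrite eq_complex/= oner_eq0.
have E2 : cexp (0 +i* (atan t *+ 2)) = k ^+ 2 * ((1 + t ^+ 2)^-1)%:C.
  by rewrite mulr2n cexp_imD E1 -ca2 rmorphXn/=; ring.
have es : (2 + cos s)%:C * k = 2%:R + cexp (0 +i* s).
  rewrite /cexp/= expR0 mul1r; apply/eqP; rewrite eq_complex/=.
  by apply/andP; split; apply/eqP; rewrite /t /=; field.
have kk : k * (1 -i* t) = (1 + t ^+ 2)%:C.
  by apply/eqP; rewrite eq_complex/=; apply/andP; split; apply/eqP; ring.
have es' : 2%:R * cexp (0 +i* s) + 1 = cexp (0 +i* s) * ((2 + cos s)%:C * (1 -i* t)).
  have e1 : cexp (0 +i* s) * cexp (0 +i* (- s)) = 1.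
    by rewrite -cexp_imD subrr cexp0.
  have -> : (2 + cos s)%:C * (1 -i* t) = 2%:R + cexp (0 +i* (- s)).
    rewrite /cexp/= expR0 mul1r cosN sinN; apply/eqP; rewrite eq_complex/=.
    by apply/andP; split; apply/eqP; rewrite /t /=; field.
  by rewrite mulrDr e1 mulrC.
have t0 : (1 + t ^+ 2)%:C != 0 :> R[i].
  by rewrite -cmod_eq0 cmod_real normr_eq0 gt_eqF.
have cC0 : (2 + cos s)%:C != 0 :> R[i] by rewrite -cmod_eq0 cmod_real normr_eq0.
rewrite es' -es /angle cexp_imD.
have -> : 0 +i* (- (atan t *+ 2)) = - (0 +i* (atan t *+ 2)) :> R[i].
  by apply/eqP; rewrite eq_complex/= oppr0 !eqxx.
rewrite cexpN E2 fmorphV/= -kk.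
have kb0 : 1 -i* t != 0 :> R[i] by rewrite eq_complex/= oner_eq0.
clear -k0 kb0 cC0; move: k0 kb0 cC0; move: k (1 -i* t) (_%:C) => k k' c k0 kb0 cC0.
by field; rewrite ?k0 ?kb0 ?cC0.
Qed.

Lemma unit_circle w : cmod w = 1 -> exists2 s : R, 0 <= s <= pi *+ 2 & w = cexp (0 +i* s).
Proof.
case: w => x y; rewrite cmod_sqrt/= => xy1.
have xy : x ^+ 2 + y ^+ 2 = 1.
  by rewrite -[LHS]sqr_sqrtr ?addr_ge0 ?sqr_ge0// xy1 expr1n.
have x1 : -1 <= x <= 1.
  by rewrite -ler_norml -[leRHS]sqrtr1 -sqrtr_sqr ler_wsqrtr// -xy lerDl sqr_ge0.
have pi0 := @pi_gt0 R.
have a0 := acos_ge0 x1; have api := acos_lepi x1.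
have sy : sin (acos x) = `|y|.
  by rewrite sin_acos// -xy addrAC subrr add0r sqrtr_sqr.
have [y0|y0] := leP 0 y.
  exists (acos x); first by apply/andP; split => //; lra.
  by rewrite /cexp/= expR0 mul1r acosK// sy ger0_norm.
exists (pi *+ 2 - acos x); first by apply/andP; split; lra.
rewrite /cexp/= expR0 mul1r cosB sinB cos2pi sin2pi acosK// sy ltr0_norm//.
by apply/eqP; rewrite eq_complex/=; apply/andP; split; apply/eqP; ring.
Qed.

End CircleMeans.

(** * From the Nevanlinna characteristic to a pointwise bound *)

Section NevanlinnaGrowth.
Context (R : realType).
Implicit Types (f : R[i] -> R[i]) (z w : R[i]).
Let mu := @lebesgue_measure R.

Lemma logp_ge0 (x : R) : 0 <= logp x.
Proof. by rewrite le_max lexx. Qed.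

(** Since [logp u = ln (1 + max (0, u - 1))], the truncated logarithm is Lipschitz. Hence
    [circle_log] is continuous even at zeros of [f]. *)
Lemma logp_lipschitz (x y : R) : `|logp x - logp y| <= `|x - y|.
Proof.
have E u : logp u = ln (1 + `|Num.max 0 (u - 1)|).
  rewrite ger0_norm ?le_max ?lexx// /logp.
  have [u1|u1] := leP u 1.
    by rewrite !max_l ?ln_le0 ?subr_le0// addr0 ln1.
  by rewrite !max_r ?ln_ge0 ?subr_ge0 ?(ltW u1)// addrC subrK.
rewrite !E; apply: le_trans (ln1D_lipschitz _ _) _.
rewrite ler_norml; apply/andP; split.
  have := ler_norm (y - x); rewrite distrC => h.
  by case: (leP 0 (x - 1)); case: (leP 0 (y - 1)); have := normr_ge0 (x - y); lra.
have h := ler_norm (x - y).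
by case: (leP 0 (x - 1)); case: (leP 0 (y - 1)); have := normr_ge0 (x - y); lra.
Qed.

Lemma le_expR_logp (x : R) : x <= expR (logp x).
Proof.
have [x0|x0] := leP x 0; first by rewrite (le_trans x0)// expR_ge0.
by rewrite -{1}[x]lnK// ler_expR /logp le_max lexx orbT.
Qed.

Definition circle_log f (r t : R) : R := logp (cmod (f (r%:C * cexp (0 +i* t)))).

Lemma circle_log_continuous f r : entire f -> continuous (circle_log f r).
Proof.
move=> ef t; apply/cvgrPdist_lt => e e0.
have : ccont (fun w => f (r%:C * cexp w)) (0 +i* t).
  apply: (@cont_comp _ (fun w => r%:C * cexp w)).
    exact: contM (cont_cst _ _) (cdiff_cont (cdiff_cexp _)).
  exact/cdiff_cont/entire_cdiff.
move=> /ccontP/(_ e e0)[d d0 hd]; apply/nbhs_normP; exists d => //= s.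
rewrite /ball_/= => st; apply: le_lt_trans (logp_lipschitz _ _) _.
have : cmod (f (r%:C * cexp (0 +i* s)) - f (r%:C * cexp (0 +i* t))) < e.
  apply: hd; rewrite (_ : _ - _ = 0 +i* (s - t)).
    by rewrite cmod_sqrt/= expr0n add0r sqrtr_sqr distrC.
  by apply/eqP; rewrite eq_complex/= subrr !eqxx.
move=> h; apply: le_lt_trans h; rewrite distrC.
move: (f _) (f _) => p q; rewrite ler_norml; apply/andP; split.
  by have := cmodD (p - q) q; rewrite subrK (cmodBC q p); lra.
by have := cmodD (q - p) p; rewrite subrK; lra.
Qed.

Lemma circle_log_period f r t : circle_log f r (t + pi *+ 2) = circle_log f r t.
Proof.
by rewrite /circle_log cexp_imD -[0 +i* (pi *+ 2)]add0r cexp_period cexp0 mulr1.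
Qed.

(* Poisson-Jensen, with the disc |w| < 2 |z| mapped to the unit disc so that z
   goes to 0.  Instead of log |f| being subharmonic, the maximum principle is
   applied to the product of the rotates of f by the n-th roots of unity, for n
   large. *)
Lemma poisson_bound f z : entire f -> z != 0 ->
  cmod (f z) <=
    expR (3 / (pi *+ 2) * \int[mu]_(t in `[0, pi *+ 2]) circle_log f (2 * cmod z) t).
Proof.
move=> ef z0.
set I := \int[mu]_(t in _) _.
have pi0 := @pi_gt0 R.
have p20 : 0 < pi *+ 2 :> R by rewrite mulrn_wgt0.
have cz0 : 0 < cmod z by rewrite cmod_gt0.
(* [V] is differentiable only on [0 <= x]. As [angle s > s - pi], taking [al] at least [pi *+ 2]
   keeps [th s] there. *)
have [al alI zE] : exists2 al : R, pi *+ 2 <= al & z = (cmod z)%:C * cexp (0 +i* al).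
  have zC0 : (cmod z)%:C != 0 :> R[i] by rewrite -cmod_eq0 cmod_real normr_eq0 gt_eqF.
  have [|s /andP[s0 _] sE] := @unit_circle R (z / (cmod z)%:C).
    by rewrite cmodM cmodV cmod_real gtr0_norm// mulfV// gt_eqF.
  exists (s + pi *+ 2); first by rewrite lerDr.
  rewrite cexp_imD -[0 +i* (pi *+ 2)]add0r cexp_period cexp0 mulr1 -sE.
  by rewrite mulrC divfK.
pose v := circle_log f (2 * cmod z).
have cv : continuous v by exact: circle_log_continuous.
have [V dV VI] := periodic_primitive cv (circle_log_period f (2 * cmod z)).
have v0 t : 0 <= v t by exact: logp_ge0.
pose th s := al + angle s.
have dth (s : R) : is_derive s 1 th (3 / (5 + 4 * cos s)).
  rewrite -[_ / _]add0r.
  exact: (is_deriveD (is_derive_cst al s 1) (is_derive_angle s)).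
have th0 s : 0 <= s -> 0 <= th s.
  move=> s0; rewrite /th /angle; have := @atan_ltpi2 R (sin s / (2 + cos s)).
  by lra.
pose y s := v (th s).
have cy : continuous y.
  move=> s; apply: (@continuous_comp _ _ _ th v); last exact: cv.
  have [D _] := dth s.
  exact/differentiable_continuous/derivable1_diffP.
(* [th' >= 1/3] and [v >= 0] give [v (th s) <= W' s], and [W] grows by [3 * I] over a period. *)
pose W s := 3 * V (th s).
pose dW s := 3 * (v (th s) * (3 / (5 + 4 * cos s))).
have dWW (s : R) : 0 <= s -> is_derive s 1 W (dW s).
  move=> s0.
  have h := @is_derive1_comp _ V th _ _ _ (dV _ (th0 s s0)) (dth s).
  exact: (is_deriveZ 3 h).
have yW (s : R) : 0 <= s -> y s <= dW s.
  move=> _; rewrite /y /dW mulrCA ler_peMr//.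
  have c1 := @cos_le1 R s; have c2 := @cos_geN1 R s.
  by rewrite mulrA ler_pdivlMr; lra.
have WI s : 0 <= s -> W (s + pi *+ 2) - W s = 3 * I.
  move=> s0; have VI' : V (th s + pi *+ 2) - V (th s) = I := VI _ (th0 s s0).
  rewrite /W -mulrBr -VI'.
  by rewrite /th angle_period addrA.
have [fz0|fz0] := eqVneq (cmod (f z)) 0; first by rewrite fz0 expR_ge0.
have fz_gt0 : 0 < cmod (f z) by rewrite lt0r fz0 cmod_ge0.
rewrite -[leLHS]lnK// ler_expR; apply/ler_addgt0Pr => e e0.
have [n n0 hn] := riemann_sum_le cy dWW yW e0.
have nR0 : 0 < n%:R :> R by rewrite ltr0n.
pose M := expR (n%:R * (3 / (pi *+ 2) * I + e)).
(* The Moebius factor sends 0 to 1/2 and preserves the unit circle, so [psi 0 = z] and [psi] maps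
   the unit circle to the circle of radius [2 |z|]. *)
pose psi w : R[i] := 2%:R * z * ((2%:R * w + 1) / (2%:R + w)).
pose om j : R[i] := cexp (0 +i* (j%:R * (pi *+ 2 / n%:R))).
have om1 j : cmod (om j) = 1 by rewrite cmod_cexp expR0.
(* All factors equal [f z] at 0, while on the unit circle [log |G|] is at most a sum of [y] over [n]
   equally spaced nodes. *)
pose G w := \prod_(j < n) f (psi (w * om j)).
have dG w : cmod w <= 1 -> cdiff G w.
  move=> w1; apply: cdiff_prod => j.
  apply: (@cdiff_comp _ (fun w => psi (w * om j))); last exact: entire_cdiff.
  apply: (@cdiff_comp _ (fun w => w * om j)).
    exact: cdiffM (cdiff_id _) (cdiff_cst _ _).
  apply: cdiffM; first exact: cdiff_cst.
  apply: cdiffM.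
    exact: cdiffD (cdiffM (cdiff_cst _ _) (cdiff_id _)) (cdiff_cst _ _).
  apply: cdiffV; last exact: cdiffD (cdiff_cst _ _) (cdiff_id _).
  rewrite addrC -subr_eq0 -[_ - 0]addr0; apply/eqP => h.
  have : cmod (w * om j) = 2.
    move: h; rewrite subr0 addr0 => /eqP; rewrite addr_eq0 => /eqP ->.
    by rewrite cmodN cmod_nat.
  by rewrite cmodM om1; lra.
have GM w : cmod w = 1 -> cmod (G w) <= M.
  move=> w1; have [s s2 wE] := unit_circle w1.
  have fy j : cmod (f (psi (w * om j))) <= expR (y (s + j%:R * (pi *+ 2 / n%:R))).
    rewrite /psi wE -cexp_imD cexp_angle {1}zE.
    set t := s + _.
    have -> : 2%:R * ((cmod z)%:C * cexp (0 +i* al)) * cexp (0 +i* angle t) =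
        (2 * cmod z)%:C * cexp (0 +i* th t).
      by rewrite /th cexp_imD rmorphM/= rmorph_nat; ring.
    exact: le_expR_logp.
  have prodle : cmod (G w) <= \prod_(j < n) expR (y (s + j%:R * (pi *+ 2 / n%:R))).
    by rewrite /G cmod_prod; apply: ler_prod => j _; rewrite cmod_ge0/=; exact: fy.
  apply: le_trans prodle _; rewrite -expR_sum /M ler_expR.
  have := hn s s2; rewrite WI; last by case/andP: s2.
  rewrite -(ler_pM2r (divr_gt0 nR0 p20)).
  have -> : pi *+ 2 / n%:R * (\sum_(j < n) y (s + j%:R * (pi *+ 2 / n%:R))) * (n%:R / (pi *+ 2)) =
     \sum_(j < n) y (s + j%:R * (pi *+ 2 / n%:R)).
    by rewrite mulrAC mulrA divfK ?gt_eqF// divff ?gt_eqF// mul1r.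
  have E (P x c m : R) : P != 0 -> (3 * x + P * c) * (m / P) = m * (3 / P * x + c).
    by move=> P0; field.
  by rewrite E ?gt_eqF.
have G0 : G 0 = f z ^+ n.
  rewrite /G (eq_bigr (fun=> f z)) ?prodr_const ?card_ord// => j _.
  by rewrite mul0r /psi mulr0 add0r addr0; congr f; field.
have : cmod (G 0) <= M.
  apply: (max_principle ltr01 (cdiff_cont (dG 0 _))) => [|w|w].
  - by rewrite cmod0 ler01.
  - by rewrite subr0 => /andP[_]; exact: dG.
  - by rewrite subr0; exact: GM.
rewrite G0 cmodX /M expRM_natl ler_pXn2r ?nnegrE ?cmod_ge0 ?expR_ge0//.
by rewrite -{1}[cmod (f z)]lnK// ler_expR.
Qed.

Lemma pole_mult_entire f p : entire f -> pole_mult f p = 0%E.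
Proof.
move=> ef; apply/eqP; rewrite eq_le; apply/andP; split; last first.
  by apply: le_ereal_inf_tmp => _ [k _ <-]; rewrite lee_fin.
apply: ereal_inf_lbound; exists 0%N => //=.
have /ccontP/(_ 1 ltr01)[d d0 hd] := cdiff_cont (entire_cdiff p ef).
exists (1 + cmod (f p))%:C; split; first by apply/complex_realP; exists (1 + cmod (f p)).
move=> M hM; apply/nbhs_normP; exists d%:C => /=; first by rewrite ltcR.
move=> w /= wd _; rewrite expr0 mul1r; apply: ltW; apply: le_lt_trans hM.
rewrite cmodE lecR; have : cmod (f w - f p) < 1.
  by apply: hd; move: wd; rewrite /ball_/= distrC cmodE ltcR.
by have := cmodD (f w - f p) (f p); rewrite subrK; lra.
Qed.

Lemma pole_count_entire f t : entire f -> pole_count f t = 0%E.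
Proof. by move=> ef; apply: esum1 => p _; exact: pole_mult_entire. Qed.

Lemma nevanlinna_char_entire f (r : R) : entire f ->
  nevanlinna_char f r =
    ((pi *+ 2)^-1 * \int[mu]_(t in `[0, pi *+ 2]) circle_log f r t)%:E.
Proof.
move=> ef; rewrite /nevanlinna_char /integrated_count pole_count_entire// mul0e adde0.
rewrite integral0_eq ?adde0; last first.
  by move=> t _; rewrite pole_count_entire// sube0 mul0e.
rewrite /proximity EFinM; congr (_ * _)%E.
rewrite /Rintegral fineK//; apply: integrable_fin_num => //.
apply: continuous_compact_integrable; first exact: segment_compact.
exact/continuous_subspaceT/circle_log_continuous.
Qed.

Lemma finite_order_growth f : (growth_order f < +oo)%E ->
  exists k, exists2 r0 : R, 1 <= r0 &
    forall r, r0 <= r -> (nevanlinna_char f r <= (r ^+ k)%:E)%E.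
Proof.
rewrite /growth_order limf_esupE => /ereal_inf_lt[_ [A [A0 [_ hA]] <-]] sA.
have [k hk] : exists k : nat, (ereal_sup ((fun r : R =>
    Order.max 0%E (lne (nevanlinna_char f r)) * ((ln r)^-1)%:E)%E @` A) <= (k%:R)%:E)%E.
  case: (ereal_sup _) sA => [s _| //|_]; last by exists 0%N; rewrite leNye.
  exists (Num.Def.archi_bound `|s|); rewrite lee_fin.
  by rewrite (le_trans (ler_norm s))// ltW// archi_boundP.
(* Beyond [expR 1] one has [ln r >= 1], so the division by [ln r] can be undone; [A0 + 1] meets the
   strict inequality that defines the neighbourhood of infinity. *)
exists k; exists (Num.max (A0 + 1) (expR 1)).
  by rewrite le_max; apply/orP; right; have := expR_ge1Dx (1 : R); lra.
move=> r; rewrite ge_max => /andP[rA re].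
have r0 : 0 < r by exact: lt_le_trans (expR_gt0 1) re.
have lnr : 1 <= ln r by rewrite -(expRK 1) ler_ln ?posrE ?expR_gt0.
have li0 : 0 < (ln r)^-1 by rewrite invr_gt0; lra.
have : (Order.max 0%E (lne (nevanlinna_char f r)) * ((ln r)^-1)%:E <= (k%:R)%:E)%E.
  apply: le_trans hk; apply: ereal_sup_ubound; exists r => //; apply: hA; lra.
have rk : 0 < r ^+ k by rewrite exprn_gt0.
case: (nevanlinna_char f r) => [t| |]; last by rewrite leNye.
- have [t0 _|t0] := leP t 0; first by rewrite lee_fin (le_trans t0)// ltW.
  rewrite lne_EFin// => h; rewrite lee_fin.
  have : ((ln t)%:E * ((ln r)^-1)%:E <= (k%:R)%:E)%E.
    by apply: le_trans h; rewrite lee_wpmul2r ?lee_fin ?(ltW li0)// le_max lexx orbT.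
  rewrite -EFinM lee_fin ler_pdivrMr; last lra.
  by rewrite mulr_natl -lnXn// ler_ln ?posrE.
(* An infinite characteristic would make the quotient infinite, against the bound [k]. *)
- by rewrite /= max_r ?leey// gt0_mulye ?lte_fin// leye_eq.
Qed.

Lemma finite_order_bound f : entire f -> (growth_order f < +oo)%E ->
  exists2 K : R, 0 <= K & exists k,
    forall z, cmod (f z) <= expR (K * (1 + cmod z) ^+ k).
Proof.
move=> ef /finite_order_growth[k [r0 r01 hr]].
have pi0 := @pi_gt0 R.
have p20 : 0 < pi *+ 2 :> R by rewrite mulrn_wgt0.
have far z : r0 <= cmod z -> cmod (f z) <= expR (3 * (2 * cmod z) ^+ k).
  move=> zr; have z0 : z != 0 by rewrite -cmod_gt0; lra.
  apply: le_trans (poisson_bound ef z0) _; rewrite ler_expR.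
  have : r0 <= 2 * cmod z by lra.
  move=> /hr; rewrite nevanlinna_char_entire// lee_fin => h.
  by rewrite -mulrA ler_pM2l.
exists (3 * (4 * r0) ^+ k); first by rewrite mulr_ge0// exprn_ge0; lra.
exists k => z.
have cz := cmod_ge0 z.
(* Every [w] on this circle satisfies [r0 <= |w| <= r0 + 2 |z|], so [far] applies whatever the size
   of [z], and [2 |w| <= 4 r0 (1 + |z|)] explains the constant. *)
apply: (@max_principle _ f z (r0 + cmod z)); first lra.
- exact/cdiff_cont/entire_cdiff.
- by move=> w _; exact: entire_cdiff.
move=> w wz.
have w1 : r0 <= cmod w by have := cmodB w z; rewrite wz; lra.
have w2 : cmod w <= r0 + 2 * cmod z by have := cmodD (w - z) z; rewrite subrK wz; lra.
apply: le_trans (far w w1) _; rewrite ler_expR -mulrA ler_pM2l// -exprMn.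
have rz : 0 <= (r0 - 1) * cmod z by rewrite mulr_ge0//; lra.
by apply: lerXn2r; rewrite ?nnegrE; lra.
Qed.

End NevanlinnaGrowth.

Theorem theorem3p1 (R : realType) (g h u v : {poly R[i]}) (a b eta : R[i])
    (f : R[i] -> R[i]) :
  a * b * eta != 0 ->
  entire f ->
  (growth_order f < +oo)%E ->
  (exists z : R[i], Lop g h u v eta f z != 0) ->
  (forall z : R[i], f z ^+ 2 + Lop g h u v eta f z = b * cexp (a * z)) ->
  let f0 : {poly R[i]} :=
    - 2^-1 *: (cexp (a * eta / 2) *: g + (a / 2) *: h + u) in
  f0 != 0 /\
  exists c : R[i],
    c ^+ 2 = b /\ forall z : R[i], f z = c * cexp (a / 2 * z) + f0.[z].
Proof.
rewrite !mulf_eq0 !negb_or => /andP[/andP[a0 b0] _] ef fo Ln0 feq f0.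
have [K K0 [k fK]] := finite_order_bound ef fo.
have [C [N fC]] := bootstrap ef feq K0 fK.
have [||c cb [p fE]] := exp_plus_poly (C := C) (N := N) a0 b0 (fun z => entire_cdiff z ef).
- by move=> z; have [] := fC z.
- by move=> z; have [] := fC z.
have [pE p0] := exp_poly_solution a0 b0 ef Ln0 feq cb fE.
by rewrite /f0 -pE; split => //; exists c.
Qed.
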